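(* Let $\mathfrak{T}$ be a tree that is ideal, monofolic, well-founded, focal and variegated. Well-order the set of leafless paths in $\mathfrak{T}$ as $\mathcal{P} := \{A_i : i \in \alpha\}$ for some limit ordinal $\alpha$. Let $\mathfrak{E}$ be the trivial tree (one node, empty order relation). For each $i \in \alpha$, define $\mathfrak{T}_i$ as follows: $\mathfrak{T}_0 := \mathfrak{T}$; for each $j \in \alpha$, $\mathfrak{T}_{j+1} := \mathfrak{T}_j +_{A_j} \mathfrak{E}$; for each limit ordinal $\gamma \in \alpha$, $\mathfrak{T}_\gamma := \bigcup_{j \in \gamma} \mathfrak{T}_j$. Then (i) $\mathfrak{T}_i \preceq \mathfrak{T}_j$ for all $i,j \in \alpha$ with $i<j$, and (ii) $\mathfrak{T}_i$ is variegated for each $i \in \alpha$. Moreover, $\mathfrak{T} \preceq \mathfrak{T} +_{\mathcal{P}} \mathfrak{E}$.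
   Context: A tree is a structure $\mathfrak{T}=(T;<)$ with $T$ non-empty and $<$ a strict partial order that is downwards linear (each set $\{x : x \leqslant t\}$ is totally ordered) and downwards connected (for all $s,t$ there is $x$ with $x\leqslant s$ and $x\leqslant t$). The language may be expanded by finitely many constants and unary predicates; $\mathcal{L}(\mathfrak{T})$ is the resulting first-order language. Elements of $T$ are called nodes. A path is a maximal linearly ordered subset; a leaf is a $<$-maximal node; a path is leafless (open) if it has no greatest element and closed if it has one. $(-\infty,x)=\{y : y<x\}$. Write $x \smile y$ if $x<y$, $y<x$ or $x=y$. Natural numbers include $0$. $\preceq$ denotes elementary substructure. Sum: for a tree $\mathfrak{T}$, a path $L$ of $\mathfrak{T}$ and a forest $\mathfrak{F}$ (here $\mathfrak{F}=\mathfrak{E}$), $\mathfrak{T}+_L\mathfrak{F}$ is the disjoint union of $T$ and $F$, with the orders of $\mathfrak{T}$ and $\mathfrak{F}$ retained (as well as constants and predicates), and in addition $x<y$ for all $x\in L$, $y\in F$; $\mathfrak{T}$ is identified with its copy in the sum. Thus $\mathfrak{T}+_L\mathfrak{E}$ adds one new leaf immediately above the path $L$. $\mathfrak{T}+_{\mathcal{P}}\mathfrak{E}$ is the tree obtained from $\mathfrak{T}$ by adding, for each path $A\in\mathcal{P}$, one new leaf $e_A$ whose set of strict predecessors is exactly $A$. Well-founded: every non-empty set of nodes has a minimal element. Ideal: for each leaf $x$ and each $y<x$ there is $z$ with $y<z<x$. Monofolic: for each leaf $x$ and each node $y$, if every $z<x$ satisfies $z<y$, then $y=x$. Focal: for each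 node $a$ and each $\mathcal{L}(\mathfrak{T})$-formula $\varphi(x,y)$, if there is $b\geqslant a$ with $\mathfrak{T}\models\varphi(a,b)$, then for each $c\geqslant a$ there is $d\geqslant a$ with $d\smile c$ and $\mathfrak{T}\models\varphi(a,d)$. $\equiv^n$ denotes agreement on all first-order sentences of quantifier rank at most $n$. For a finite relational language with constants, $\tau^n_1(x),\ldots,\tau^n_m(x)$ is the finite list (up to logical equivalence) of $n$-characteristic formulas in one free variable: formulas of quantifier rank $n$ such that each element of each structure satisfies exactly one of them, and $a$ in $\mathfrak{A}$ and $b$ in $\mathfrak{B}$ satisfy the same one iff $(\mathfrak{A};a)\equiv^n(\mathfrak{B};b)$. For a path $A$, $A^-$ is $A$ with its leaf (if any) removed. The $n$-spectrum of $A$ in $\mathfrak{T}$ is the set of $i$ for which $\{t\in A^- : \mathfrak{T}\models\tau^n_i(t)\}$ is cofinal in $A^-$ (formulas $\tau_i^n$ in the language $\mathcal{L}(\mathfrak{T})$). $\mathfrak{T}$ is variegated if for each natural number $n$, each open path $B$ in $\mathfrak{T}$ and each finite tuple $\bar a$ from $T$, if $B$ has $n$-spectrum $X$ in $(\mathfrak{T};\bar a)$ then there is a closed path $C$ in $\mathfrak{T}$ that also has $n$-spectrum $X$ in $(\mathfrak{T};\bar a)$ (characteristic formulas in the language $\mathcal{L}(\mathfrak{T};\bar a)$).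
   Formalization: When the language has unary predicates, the single node of the trivial tree is required to satisfy exactly those predicates that hold at the leaves of the given tree; with any other labelling the new leaf could falsify ''every leaf satisfies P'' and the claim would fail. *)

(* Defs.v *)
From mathcomp Require Import all_boot all_order.
From mathcomp Require Import boolp classical_sets functions.

Set Implicit Arguments.
Unset Strict Implicit.
Unset Printing Implicit Defensive.

Local Open Scope classical_set_scope.

(* One binary relation symbol, finitely many constants and finitely many unary
   predicates. *)
Record language := Language { const_sym : finType; pred_sym : finType }.

Record structure (L : language) := Structure {
  carrier :> Type;
  slt : carrier -> carrier -> Prop;
  iconst : const_sym L -> carrier;
  upred : pred_sym L -> carrier -> Prop }.

Inductive term (L : language) (n : nat) :=
  | Var of 'I_n
  | Cst of const_sym L.

(* [formula L n]: formulas with free variables among 0, ..., n - 1.  The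
   variable bound by [All] is variable 0 of its body, the free variables of the
   whole formula being shifted by one. *)
Inductive formula (L : language) : nat -> Type :=
  | Bot n : formula L n
  | Eq n of term L n & term L n : formula L n
  | Lt n of term L n & term L n : formula L n
  | Pred n of pred_sym L & term L n : formula L n
  | Imp n of formula L n & formula L n : formula L n
  | All n of formula L n.+1 : formula L n.

Fixpoint qrank L n (phi : formula L n) : nat :=
  match phi with
  | Imp _ p q => maxn (qrank p) (qrank q)
  | All _ p => (qrank p).+1
  | _ => 0
  end.

Definition eval L (M : structure L) n (v : n.-tuple M) (t : term L n) : M :=
  match t with Var i => tnth v i | Cst c => iconst M c end.

Fixpoint sat L (M : structure L) n (phi : formula L n) : n.-tuple M -> Prop :=
  match phi in formula _ n return n.-tuple M -> Prop with
  | Bot _ => fun _ => False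
  | Eq _ s t => fun v => eval v s = eval v t
  | Lt _ s t => fun v => slt (eval v s) (eval v t)
  | Pred _ p t => fun v => upred p (eval v t)
  | Imp _ p q => fun v => sat p v -> sat q v
  | All _ p => fun v => forall x : M, sat p [tuple of x :: v]
  end.

Definition equiv_upto L (n : nat) (M N : structure L) : Prop :=
  forall phi : formula L 0,
    qrank phi <= n -> (sat phi [tuple of [::] : seq M] <->
                       sat phi [tuple of [::] : seq N]).

(* The inclusion [f] exhibits [M] as an elementary substructure of [N]. *)
Definition elementary L (M N : structure L) (f : M -> N) : Prop :=
  forall n (phi : formula L n) (v : n.-tuple M),
    sat phi v <-> sat phi (map_tuple f v).

Definition embedding L (M N : structure L) (f : M -> N) : Prop :=
  [/\ injective f,
      forall x y, slt (f x) (f y) <-> slt x y,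
      forall c, f (iconst M c) = iconst N c &
      forall p x, upred p (f x) <-> upred p x].

Definition isomorphism L (M N : structure L) (f : M -> N) : Prop :=
  embedding f /\ forall y, exists x, f x = y.

Definition expand_language (L : language) (k : nat) : language :=
  Language (const_sym L + 'I_k)%type (pred_sym L).

Definition expand L (M : structure L) k (a : k.-tuple M) :
    structure (expand_language L k) :=
  @Structure (expand_language L k) M (@slt L M)
    (fun c => match c with inl c => iconst M c | inr i => tnth a i end)
    (@upred L M).

Definition characteristic L (n m : nat) (tau : 'I_m -> formula L 1) : Prop :=
  [/\ forall i, qrank (tau i) = n,
      forall (M : structure L) (a : M), exists! i, sat (tau i) [tuple a] &
      forall (M N : structure L) (a : M) (b : N),
        (exists i, sat (tau i) [tuple a] /\ sat (tau i) [tuple b]) <->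
        equiv_upto n (expand [tuple a]) (expand [tuple b])].

Definition sle L (T : structure L) (x y : T) : Prop := slt x y \/ x = y.

Definition comparable_nodes L (T : structure L) (x y : T) : Prop :=
  [\/ slt x y, slt y x | x = y].

Definition is_tree L (T : structure L) : Prop :=
  [/\ inhabited T,
      forall x : T, ~ slt x x,
      forall x y z : T, slt x y -> slt y z -> slt x z,
      forall t x y : T, sle x t -> sle y t -> comparable_nodes x y &
      forall s t : T, exists x, sle x s /\ sle x t].

Definition leaf L (T : structure L) (x : T) : Prop := forall y, ~ slt x y.

Definition linear_set L (T : structure L) (A : set T) : Prop :=
  forall x y, A x -> A y -> comparable_nodes x y.

Definition tree_path L (T : structure L) (A : set T) : Prop :=
  linear_set A /\ forall B : set T, linear_set B -> A `<=` B -> B = A.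

Definition closed_path L (T : structure L) (A : set T) : Prop :=
  tree_path A /\ exists2 x, A x & forall y, A y -> sle y x.

Definition open_path L (T : structure L) (A : set T) : Prop :=
  tree_path A /\ ~ exists2 x, A x & forall y, A y -> sle y x.

Definition well_founded_tree L (T : structure L) : Prop :=
  forall X : set T, X !=set0 -> exists2 x, X x & forall y, X y -> ~ slt y x.

Definition ideal L (T : structure L) : Prop :=
  forall x y : T, leaf x -> slt y x -> exists z, slt y z /\ slt z x.

Definition monofolic L (T : structure L) : Prop :=
  forall x y : T, leaf x -> (forall z, slt z x -> slt z y) -> y = x.

Definition focal L (T : structure L) : Prop :=
  forall (a : T) (phi : formula L 2),
    (exists b, sle a b /\ sat phi [tuple a; b]) ->
    forall c, sle a c ->
      exists d, [/\ sle a d, comparable_nodes d c & sat phi [tuple a; d]].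

Definition without_leaf L (T : structure L) (A : set T) : set T :=
  [set t | A t /\ ~ leaf t].

Definition cofinal L (T : structure L) (A X : set T) : Prop :=
  X `<=` A /\ forall s, A s -> exists2 t, X t & sle s t.

Definition spectrum L (T : structure L) m (tau : 'I_m -> formula L 1)
    (A : set T) : set 'I_m :=
  [set i | cofinal (without_leaf A)
             [set t | without_leaf A t /\ sat (tau i) [tuple t]]].

Definition variegated L (T : structure L) : Prop :=
  forall (n : nat) (B : set T) (k : nat) (a : k.-tuple T)
         (m : nat) (tau : 'I_m -> formula (expand_language L k) 1),
    open_path B -> characteristic n tau ->
    exists2 C : set T, closed_path C &
      spectrum (T := expand a) tau C = spectrum (T := expand a) tau B.

(* The constants of a sum are those of its left summand, so the right summand
   interprets the predicates only. *)
Definition no_const (L : language) : language :=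
  Language void (pred_sym L).

Section Sum.
Variables (L : language) (T : structure L) (A : set T).
Variable (F : structure (no_const L)).

Definition sum_lt (x y : T + F) : Prop :=
  match x, y with
  | inl x, inl y => slt x y
  | inl x, inr _ => A x
  | inr _, inl _ => False
  | inr x, inr y => slt x y
  end.

Definition sum_pred (p : pred_sym L) (x : T + F) : Prop :=
  match x with
  | inl x => upred p x
  | inr x => @upred (no_const L) F p x
  end.

Definition tree_sum : structure L :=
  @Structure L (T + F)%type sum_lt (fun c => inl (iconst T c)) sum_pred.

End Sum.

(* The one-node tree with empty order.  When the language has unary predicates,
   their values at the node are part of the structure; they are given by [q]. *)
Definition trivial_tree (L : language) (q : pred_sym L -> Prop) :
    structure (no_const L) :=
  @Structure (no_const L) unit (fun _ _ => False) (of_void unit)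
    (fun p _ => q p).

(* [T +_P E] with [E = trivial_tree q]: the node [inr A] is the new leaf above
   the path [A] of [P]. *)
Section AddLeaves.
Variables (L : language) (T : structure L) (P : set (set T)).
Variable (q : pred_sym L -> Prop).

Definition add_leaves_lt (x y : T + {A : set T | P A}) : Prop :=
  match x, y with
  | inl x, inl y => slt x y
  | inl x, inr A => sval A x
  | inr _, _ => False
  end.

Definition add_leaves_pred (p : pred_sym L) (x : T + {A : set T | P A}) : Prop :=
  match x with
  | inl x => upred p x
  | inr _ => q p
  end.

Definition add_leaves : structure L :=
  @Structure L (T + {A : set T | P A})%type add_leaves_lt
    (fun c => inl (iconst T c)) add_leaves_pred.

Definition add_leaves_incl : T -> add_leaves := inl.

End AddLeaves.

(* Ordinals are represented by well-ordered types. *)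
Definition is_least d (I : orderType d) (i : I) : Prop :=
  forall j, (i <= j)%O.

Definition is_succ d (I : orderType d) (i j : I) : Prop :=
  (i < j)%O /\ forall k, (i < k)%O -> (j <= k)%O.

Definition is_limit d (I : orderType d) (j : I) : Prop :=
  ~ is_least j /\ forall i, ~ is_succ i j.

(* [stage i] is T_i.  Inclusions between the T_i are explicit maps: [stage_base i]
   identifies T inside T_i, and [stage_incl] identifies T_i inside T_j for i < j.
   A union is a structure into which all earlier ones embed, compatibly and with
   jointly surjective images.  The path [A i] of T is regarded as a path of T_i
   through [stage_base i]. *)
Record sum_sequence L (T : structure L) (E : structure (no_const L))
    d (I : orderType d) (A : I -> set T) := SumSequence {
  stage :> I -> structure L;
  stage_base : forall i, T -> stage i;
  stage_incl : forall i j, (i < j)%O -> stage i -> stage j;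
  stage_incl_base : forall i j (ij : (i < j)%O) x,
    stage_incl ij (stage_base i x) = stage_base j x;
  stage_incl_trans : forall i j k
      (ij : (i < j)%O) (jk : (j < k)%O) (ik : (i < k)%O) x,
    stage_incl jk (stage_incl ij x) = stage_incl ik x;
  stage_zero : forall i, is_least i -> isomorphism (stage_base i);
  stage_succ : forall i j (ij : (i < j)%O), is_succ i j ->
    exists2 f : tree_sum (stage_base i @` A i) E -> stage j,
      isomorphism f & forall x : stage i, f (inl x) = stage_incl ij x;
  stage_limit : forall j, is_limit j ->
    (forall i (ij : (i < j)%O), embedding (stage_incl ij)) /\
    (forall y : stage j,
       exists i (ij : (i < j)%O) (x : stage i), stage_incl ij x = y) }.

Arguments stage_base {L T E d I A} s i x.
Arguments stage_incl {L T E d I A} s {i j} ij x.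

(* The hypotheses packed in [sum_sequence] can be met. *)
Section Existence.
Import Order.TTheory.

Variables (L : language) (T : structure L) (q : pred_sym L -> Prop).
Variables (d : Order.disp_t) (I : orderType d) (A : I -> set T).

Definition std_stage (i : I) : structure L :=
  @Structure L (T + {j : I | (j < i)%O})%type
    (fun x y => match x, y with
                | inl x, inl y => slt x y
                | inl x, inr j => A (sval j) x
                | inr _, _ => False
                end)
    (fun c => inl (iconst T c))
    (fun p x => match x with inl x => upred p x | inr _ => q p end).

Definition std_incl i j (ij : (i < j)%O) (x : std_stage i) : std_stage j :=
  match x with
  | inl x => inl x
  | inr (exist k h) => inr (exist _ k (lt_trans h ij))
  end.

Lemma sum_sequence_exists : inhabited (sum_sequence (trivial_tree q) A).
Proof.
constructor.
apply: (@SumSequence L T (trivial_tree q) d I A std_stage (fun i => inl) std_incl).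
- by [].
- move=> i j k ij jk ik [x|[l h]] //=; apply: (f_equal inr); by apply: val_inj.
- move=> i mi; split.
    split=> //; by move=> x y [].
  case=> [x|[j h]]; first by exists x.
  by have := mi j; rewrite leNgt h.
- move=> i j ij [_ S].
  exists (fun x : tree_sum ((inl : T -> std_stage i) @` A i) (trivial_tree q) =>
      match x return std_stage j with
      | inl x => std_incl ij x
      | inr _ => inr (exist _ i ij)
      end) => //.
  split; first split.
  + move=> [[x|[k hk]]|[]] [[y|[l hl]]|[]] //=.
    * by case=> ->.
    * move=> [] e; do ?[apply: (f_equal inr)]; do ?[apply: (f_equal inl)].
      by do ?[apply: (f_equal inr)]; apply: val_inj.
    * by case=> e; exfalso; clear -hk e; subst; rewrite ltxx in hk.
    * by case=> e; exfalso; clear -hl e; subst; rewrite ltxx in hl.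
  + move=> [[x|[k hk]]|[]] [[y|[l hl]]|[]] //=.
    split; first by move=> h; exists x.
    by case=> z h [<-].
    by split=> // -[].
  + by [].
  + by move=> p [[x|[k hk]]|[]].
  + move=> [x|[k hk]]; first by exists (inl (inl x)).
    have: (k <= i)%O by rewrite leNgt; apply/negP=> /S; rewrite leNgt hk.
    rewrite le_eqVlt => /orP[/eqP e|h]; last first.
      exists (inl (inr (exist _ k h))) => /=; apply: (f_equal inr); by apply: val_inj.
    subst k; exists (inr tt); apply: (f_equal inr); by apply: val_inj.
- move=> j [nl ns]; split.
  + move=> i ij; split.
    * move=> [x|[k hk]] [y|[l hl]] //=; first by case=> ->.
      case=> e; apply: (f_equal inr); by apply: val_inj.
    * by move=> [x|[k hk]] [y|[l hl]] //=.
    * by [].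
    * by move=> p [x|[k hk]].
  + move=> [x|[k hk]].
      have [i hi] : exists i, (i < j)%O.
        apply: contrapT => h; apply: nl => i; rewrite leNgt.
        by apply/negP=> h'; apply: h; exists i.
      by exists i, hi, (inl x).
    have [i ki ij] : exists2 i, (k < i)%O & (i < j)%O.
      apply: contrapT => h; apply: (ns k); split=> // i ki.
      by rewrite leNgt; apply/negP=> h'; apply: h; exists i.
    exists i, ij, (inr (exist _ k ki)) => /=; apply: (f_equal inr); by apply: val_inj.
Qed.

End Existence.

(* Main.v *)
(* Let U extend T by new leaves above distinct open
   paths.  By induction on n, every finite tuple of T has the same n-type in T
   and in U.  The case to treat is a move e of the opponent above an open path
   B: choose s in B such that no node of the tuple lies above s, and answer by
   any leaf c > s of T.  Since a cone interacts with the rest of the tree only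
   through its root, it suffices to compare (T; s, c) with (U; s, e).

   If a <= b and b is not a leaf, then the n-type of b
   over a is realised on every path through a.  For paths with a leaf this is
   focality, and variegation carries it over to open paths.  A game between
   (T; s, c) and (U; s, e) is then played by moving up along the two paths: a
   move outside of them is not above some v on its path (monofolicity
   if the path is closed), v is matched with a node u of the same type on the
   other path, the move is answered as in the tuples (s, v) and (s, u), and the
   game above v and u is again of the initial form.

   U is a tree of the same kind as T, hence the argument applies to inclusions
   between two such extensions. *)
Require Import Defs.
From mathcomp Require Import all_boot all_order.
From mathcomp Require Import boolp classical_sets functions.

Set Implicit Arguments.
Unset Strict Implicit.
Unset Printing Implicit Defensive.

Local Open Scope classical_set_scope.

(** * Ehrenfeucht-Fraisse games *)

Section Game.
Variable L : language.
Implicit Types M N P : structure L.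

(** Positions are relations rather than pairs of tuples, so that they can be cut down, composed and
    glued, and may be infinite. The equality clause makes them graphs of partial injections. *)
Definition partial_iso M N (R : M -> N -> Prop) : Prop :=
  forall a b a' b', R a b -> R a' b' ->
    [/\ a = a' <-> b = b', slt a a' <-> slt b b' &
        forall p, upred p a <-> upred p b].

Definition ext M N (R : M -> N -> Prop) (x : M) (y : N) : M -> N -> Prop :=
  fun a b => R a b \/ (a = x /\ b = y).

Fixpoint game M N (n : nat) (R : M -> N -> Prop) : Prop :=
  if n is n'.+1 then
    [/\ partial_iso R, forall x, exists y, game n' (ext R x y) &
        forall y, exists x, game n' (ext R x y)]
  else partial_iso R.

(** [game] does not look at constants; a position that is to respect them must contain these
    pairs. *)
Definition consts M N (a : M) (b : N) : Prop :=
  exists c, a = iconst M c /\ b = iconst N c.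

Definition env M N k (v : k.-tuple M) (w : k.-tuple N) (a : M) (b : N) : Prop :=
  consts a b \/ exists i, a = tnth v i /\ b = tnth w i.

Lemma game_sub M N n (R R' : M -> N -> Prop) :
  (forall a b, R' a b -> R a b) -> game n R -> game n R'.
Proof.
elim: n R R' => [|n IH] R R' sub /=; first by move=> H a b a' b' /sub h /sub; exact: H.
case=> H F B; split; first by move=> a b a' b' /sub h /sub; exact: H.
- move=> x; have [y h] := F x; exists y; apply: IH h.
  by move=> a b [/sub|]; [left|right].
- move=> y; have [x h] := B y; exists x; apply: IH h.
  by move=> a b [/sub|]; [left|right].
Qed.

Lemma game_iso M N n (R : M -> N -> Prop) : game n R -> partial_iso R.
Proof. by case: n => [//|n] []. Qed.

Lemma game_forth M N n (R : M -> N -> Prop) x :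
  game n.+1 R -> exists y, game n (ext R x y).
Proof. by case. Qed.

Lemma game_back M N n (R : M -> N -> Prop) y :
  game n.+1 R -> exists x, game n (ext R x y).
Proof. by case. Qed.

Lemma gameS M N n (R : M -> N -> Prop) : game n.+1 R -> game n R.
Proof.
elim: n R => [|n IH] R; first by case.
case=> H F B; split=> // [x|y].
- by have [y /IH] := F x; exists y.
- by have [x /IH] := B y; exists x.
Qed.

Lemma gameW M N n m (R : M -> N -> Prop) : n <= m -> game m R -> game n R.
Proof.
move=> /subnK <-; elim: (m - n) => [//|k IH]; rewrite addSn => /gameS; exact: IH.
Qed.

Lemma game_sym M N n (R : M -> N -> Prop) :
  game n R -> game n (fun b a => R a b).
Proof.
have iso (Q : M -> N -> Prop) : partial_iso Q -> partial_iso (fun b a => Q a b).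
  move=> H b a b' a' h h'; have [e l p] := H _ _ _ _ h h'.
  by split=> [||q]; apply: iff_sym.
elim: n R => [|n IH] R /=; first exact: iso.
case=> H F B; split; first exact: iso.
- move=> y; have [x /IH h] := B y; exists x; apply: game_sub h => b a.
  by case=> [|[-> ->]]; [left|right].
- move=> x; have [y /IH h] := F x; exists y; apply: game_sub h => b a.
  by case=> [|[-> ->]]; [left|right].
Qed.

Lemma game_trans M N P n (R : M -> N -> Prop) (R' : N -> P -> Prop) :
  game n R -> game n R' -> game n (fun a c => exists b, R a b /\ R' b c).
Proof.
have iso (Q : M -> N -> Prop) (Q' : N -> P -> Prop) :
    partial_iso Q -> partial_iso Q' ->
    partial_iso (fun a c => exists b, Q a b /\ Q' b c).
  move=> H H' a c a' c' [b [h1 h2]] [b' [h1' h2']].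
  have [e l p] := H _ _ _ _ h1 h1'; have [e' l' p'] := H' _ _ _ _ h2 h2'.
  by split=> [||r]; [rewrite e|rewrite l|rewrite p].
elim: n R R' => [|n IH] R R' /=; first exact: iso.
case=> H F B [H' F' B']; split; first exact: iso.
- move=> x; have [y h] := F x; have [z h'] := F' y; exists z.
  apply: game_sub (IH _ _ h h') => a c [[b [r r']]|[-> ->]].
    by exists b; split; left.
  by exists y; split; right.
- move=> z; have [y h'] := B' z; have [x h] := B y; exists x.
  apply: game_sub (IH _ _ h h') => a c [[b [r r']]|[-> ->]].
    by exists b; split; left.
  by exists y; split; right.
Qed.

Lemma game_refl M n : game n (fun a b : M => a = b).
Proof.
have iso : partial_iso (fun a b : M => a = b) by move=> a b a' b' <- <-.
elim: n => [//|n IH]; split=> // x; exists x; apply: game_sub IH => a b.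
- by case=> // -[-> ->].
- by case=> // -[-> ->].
Qed.

Lemma game_comparable M N n (R : M -> N -> Prop) a b a' b' :
  game n R -> R a b -> R a' b' -> comparable_nodes a a' -> comparable_nodes b b'.
Proof.
move=> /game_iso H r r'; have [e l _] := H _ _ _ _ r r'.
have [_ l' _] := H _ _ _ _ r' r.
by case=> [/l|/l'|/e]; [constructor 1|constructor 2|constructor 3].
Qed.

Lemma game_sle M N n (R : M -> N -> Prop) a b a' b' :
  game n R -> R a b -> R a' b' -> sle a a' -> sle b b'.
Proof.
move=> /game_iso H r r'; have [e l _] := H _ _ _ _ r r'.
by case=> [/l|/e]; [left|right].
Qed.

Lemma game_lt M N n (R : M -> N -> Prop) a b a' b' :
  game n R -> R a b -> R a' b' -> slt a a' <-> slt b b'.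
Proof. by move=> /game_iso H r r'; have [_ l _] := H _ _ _ _ r r'. Qed.

Lemma game_eq M N n (R : M -> N -> Prop) a b a' b' :
  game n R -> R a b -> R a' b' -> a = a' <-> b = b'.
Proof. by move=> /game_iso H r r'; have [e _ _] := H _ _ _ _ r r'. Qed.

(** A node above [b] would be answered by a node above [a], hence one round must remain. *)
Lemma game_leaf M N n (R : M -> N -> Prop) a b :
  game n.+1 R -> R a b -> leaf a -> leaf b.
Proof.
case=> _ _ B r la y lt; have [x h] := B y.
apply: (la x).
by apply: (proj2 (game_lt h (or_introl r) (or_intror (conj erefl erefl)))) lt.
Qed.

Definition forest_order M : Prop :=
  [/\ forall x : M, ~ slt x x,
      forall x y z : M, slt x y -> slt y z -> slt x z &
      forall t x y : M, sle x t -> sle y t -> comparable_nodes x y].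

(* A node outside the cone above y relates to all nodes of that cone as it
   relates to y, so strategies inside and outside the cone can be played
   independently. *)
Lemma game_glue M N (fM : forest_order M) (fN : forest_order N) n
    (R1 R2 : M -> N -> Prop) y x :
  game n R1 -> game n R2 -> R1 y x -> R2 y x ->
  game n (fun a b => (R1 a b /\ ~ slt y a) \/ (R2 a b /\ sle y a)).
Proof.
case: fM fN => irrM trM dlM [irrN trN dlN].
have iso (Q1 Q2 : M -> N -> Prop) : partial_iso Q1 -> partial_iso Q2 ->
    Q1 y x -> Q2 y x ->
    partial_iso (fun a b => (Q1 a b /\ ~ slt y a) \/ (Q2 a b /\ sle y a)).
  move=> H1 H2 r1 r2.
  have lo a b : Q1 a b -> [/\ a = y <-> b = x, slt a y <-> slt b x & slt y a <-> slt x b].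
    move=> h; have [e l _] := H1 _ _ _ _ h r1; have [_ l' _] := H1 _ _ _ _ r1 h.
    by split.
  have hi a b : Q2 a b -> [/\ a = y <-> b = x, slt a y <-> slt b x & slt y a <-> slt x b].
    move=> h; have [e l _] := H2 _ _ _ _ h r2; have [_ l' _] := H2 _ _ _ _ r2 h.
    by split.
  have down K (fK : forest_order K) (k a c : K) :
      ~ slt k a -> sle k c -> slt a c <-> (slt a k \/ (a = k /\ slt k c)).
    case: fK => irr tr dl nka kc; split.
      move=> ac; have [ak|ka|ak] : comparable_nodes a k by apply: (dl c); [left|].
      - by left.
      - by case: nka.
      - by right; rewrite -ak.
    by case=> [ak|[-> //]]; case: kc => [|<- //]; apply: tr.
  have up K (fK : forest_order K) (k a c : K) :
      ~ slt k a -> sle k c -> ~ slt c a.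
    by case: fK => irr tr dl nka [kc ca|<- //]; apply: nka; apply: tr ca.
  have equ K (fK : forest_order K) (k a c : K) :
      ~ slt k a -> sle k c -> a = c <-> (a = k /\ c = k).
    case: fK => irr tr dl nka kc; split; last by case=> -> ->.
    by move=> ac; move: kc nka; rewrite -ac => -[//|->].
  have fM : forest_order M by split.
  have fN : forest_order N by split.
  have mix a b a' b' : Q1 a b -> ~ slt y a -> Q2 a' b' -> sle y a' ->
      [/\ a = a' <-> b = b', slt a a' <-> slt b b' & slt a' a <-> slt b' b].
    move=> h nya h' ya'.
    have [e1 l1 g1] := lo _ _ h; have [e2 l2 g2] := hi _ _ h'.
    have nxb : ~ slt x b by move/g1.
    have xb' : sle x b' by case: ya' => [/g2|/esym/e2/esym]; [left|right].
    have := equ M fM y a a' nya ya'; have := equ N fN x b b' nxb xb'.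
    have := down M fM y a a' nya ya'; have := down N fN x b b' nxb xb'.
    have := up M fM y a a' nya ya'; have := up N fN x b b' nxb xb'.
    by split; tauto.
  move=> a b a' b' [[h c]|[h c]] [[h' c']|[h' c']].
  - exact: H1.
  - by have [? ? ?] := mix _ _ _ _ h c h' c'; have [] := H1 _ _ _ _ h h.
  - have [e l l'] := mix _ _ _ _ h' c' h c; have [_ _ p] := H2 _ _ _ _ h h.
    by split=> //; split=> /esym/e/esym.
  - exact: H2.
elim: n R1 R2 => [|n IH] R1 R2 /=; first exact: iso.
case=> H1 F1 B1 [H2 F2 B2] r1 r2; split; first exact: iso.
(* A move strictly above [y] is played in the second game, any other move in the first; the idle
   game just loses a round. *)
- move=> z; have [yz|nyz] := pselect (slt y z).
  + have [z' h] := F2 z; exists z'.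
    have h1 : game n R1 by apply: gameS.
    apply: game_sub (IH _ _ h1 h r1 (or_introl r2)) => a b.
    case=> [[[? ?]|[? ?]]|[-> ->]]; [by left|by right; split=> //; left|].
    by right; split; [right|left].
  + have [z' h] := F1 z; exists z'.
    have h2 : game n R2 by apply: gameS.
    apply: game_sub (IH _ _ h h2 (or_introl r1) r2) => a b.
    case=> [[[? ?]|[? ?]]|[-> ->]]; [by left; split=> //; left|by right|].
    by left; split=> //; right.
- move=> z'; have [xz|nxz] := pselect (slt x z').
  + have [z h] := B2 z'; exists z.
    have h1 : game n R1 by apply: gameS.
    apply: game_sub (IH _ _ h1 h r1 (or_introl r2)) => a b.
    case=> [[[? ?]|[? ?]]|[-> ->]]; [by left|by right; split=> //; left|].
    right; split; [by right|left].
    exact: (proj2 (game_lt h (or_introl r2) (or_intror (conj erefl erefl)))) xz.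
  + have [z h] := B1 z'; exists z.
    have h2 : game n R2 by apply: gameS.
    apply: game_sub (IH _ _ h h2 (or_introl r1) r2) => a b.
    case=> [[[? ?]|[? ?]]|[-> ->]]; [by left; split=> //; left|by right|].
    (* [y] and [x] are paired in the first game, so the answer [z] stays outside the cone as [z']
       does. *)
    left; split; first by right.
    move=> yz; apply: nxz.
    exact: (proj1 (game_lt h (or_introl r1) (or_intror (conj erefl erefl)))) yz.
Qed.

End Game.

(** * Hintikka formulas *)

Section Hintikka.
Variable L : language.

Definition term_index (k : nat) : finType := ('I_k + const_sym L)%type.

Definition index_term k (i : term_index k) : term L k :=
  match i with inl i => Var L i | inr c => Cst k c end.

Definition atom_index (k : nat) : finType :=
  (term_index k * term_index k + term_index k * term_index k +
   pred_sym L * term_index k)%type.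

Definition atom k (i : atom_index k) : formula L k :=
  match i with
  | inl (inl (s, t)) => Eq (index_term s) (index_term t)
  | inl (inr (s, t)) => Lt (index_term s) (index_term t)
  | inr (p, t) => Pred p (index_term t)
  end.

Definition fnot k (phi : formula L k) : formula L k := Imp phi (Bot L k).
Definition fand k (phi psi : formula L k) : formula L k :=
  fnot (Imp phi (fnot psi)).

(** A valid formula of rank exactly [n], used to raise the rank of a conjunction; [pad 0 k] is the
    empty conjunction. *)
Fixpoint pad (n k : nat) : formula L k :=
  if n is n'.+1 then All (pad n' k.+1) else fnot (Bot L k).

Definition description k (I : finType) (g : I -> formula L k)
    (f : {ffun I -> bool}) : formula L k :=
  foldr (fun i phi => fand (if f i then g i else fnot (g i)) phi) (pad 0 k)
    (enum I).

(* The formulas of [generator n k] decide every formula of rank at most n. *)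
Fixpoint gen_index (n k : nat) : finType :=
  if n is n'.+1 then (atom_index k + {ffun gen_index n' k.+1 -> bool})%type
  else atom_index k.

Fixpoint generator (n k : nat) : gen_index n k -> formula L k :=
  match n with
  | 0 => @atom k
  | n'.+1 => fun i => match i with
    | inl i => atom i
    | inr f => All (fnot (description (@generator n' k.+1) f))
    end
  end.

Definition type_index n k : finType := {ffun gen_index n k -> bool}.

Definition hintikka n k (f : type_index n k) : formula L k :=
  description (@generator n k) f.

Definition type_of n (M : structure L) k (v : k.-tuple M) : type_index n k :=
  [ffun i => `[<sat (generator i) v>]].

Lemma sat_pad n k (M : structure L) (v : k.-tuple M) : sat (pad n k) v.
Proof. by elim: n k v => [|n IH] k v //= x; exact: IH. Qed.

Lemma qrank_pad n k : qrank (pad n k) = n.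
Proof. by elim: n k => [//|n IH] k /=; rewrite IH. Qed.

Lemma sat_and k (M : structure L) (v : k.-tuple M) (phi psi : formula L k) :
  sat (fand phi psi) v <-> sat phi v /\ sat psi v.
Proof.
split=> [/= h|[/= ? ? h]]; last exact: h.
by split; apply: contrapT => nh; apply: h => // p q.
Qed.

Lemma qrank_and k (phi psi : formula L k) :
  qrank (fand phi psi) = maxn (qrank phi) (qrank psi).
Proof. by rewrite /= !maxn0. Qed.

Lemma sat_description k (I : finType) (g : I -> formula L k) f
    (M : structure L) (v : k.-tuple M) :
  sat (description g f) v <-> forall i, f i = `[<sat (g i) v>].
Proof.
have -> : (forall i, f i = `[<sat (g i) v>]) <->
    (forall i, i \in enum I -> f i = `[<sat (g i) v>]).
  by split=> [//|h i]; apply: h; rewrite mem_enum.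
rewrite /description; elim: (enum I) => [|i s IH]; first by split=> // _.
apply: iff_trans (sat_and _ _ _) _; rewrite IH; split.
  move=> [h hs] j; rewrite inE => /predU1P[->|/hs //].
  case: (f i) h => h; symmetry; first exact/asboolP.
  by apply/asboolP.
move=> h; split; last by move=> j js; apply: h; rewrite inE js orbT.
have := h i (mem_head _ _); case: (f i) => e.
  by apply/asboolP.
by move=> /asboolP; rewrite -e.
Qed.

Lemma sat_hintikka n k (f : type_index n k) (M : structure L) (v : k.-tuple M) :
  sat (hintikka f) v <-> type_of n v = f.
Proof.
rewrite sat_description; split=> [h|<- i]; last by rewrite ffunE.
by apply/ffunP => i; rewrite ffunE h.
Qed.

Lemma qrank_atom k (i : atom_index k) : qrank (atom i) = 0.
Proof. by case: i => [[[]|[]]|[]]. Qed.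

Lemma qrank_description n k (I : finType) (g : I -> formula L k) f :
  (forall i, qrank (g i) <= n) -> qrank (description g f) <= n.
Proof.
move=> h; rewrite /description; elim: (enum I) => [//|i s IH].
rewrite [foldr _ _ _]/= qrank_and geq_max IH andbT; case: (f i) => //=.
by rewrite maxn0.
Qed.

Lemma qrank_generator n k (i : gen_index n k) : qrank (generator i) <= n.
Proof.
elim: n k i => [|n IH] k /=; first by move=> i; rewrite qrank_atom.
case=> [i|f] /=; first by rewrite qrank_atom.
by rewrite maxn0 ltnS; exact: qrank_description.
Qed.

Lemma qrank_hintikka n k (f : type_index n k) : qrank (hintikka f) <= n.
Proof. exact: qrank_description (@qrank_generator n k). Qed.

Lemma env_cons (M N : structure L) k (v : k.-tuple M) (w : k.-tuple N) x y a b :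
  env [tuple of x :: v] [tuple of y :: w] a b <-> ext (env v w) x y a b.
Proof.
split.
  case=> [h|[i [-> ->]]]; first by left; left.
  case: (unliftP ord0 i) => [j ->|->]; last by right.
  by left; right; exists j; rewrite !tnthS.
case=> [[h|[i [-> ->]]]|[-> ->]]; first by left.
  by right; exists (lift ord0 i); rewrite !tnthS.
by right; exists ord0.
Qed.

Lemma eval_env (M N : structure L) k (v : k.-tuple M) (w : k.-tuple N) t :
  env v w (eval v t) (eval w t).
Proof. by case: t => [i|c]; [right; exists i|left; exists c]. Qed.

Lemma game_sat (M N : structure L) k (phi : formula L k) n v w :
  qrank phi <= n -> game n (@env L M N k v w) -> (sat phi v <-> sat phi w).
Proof.
elim: phi n v w => {k} [k|k s t|k s t|k p t|k phi IH psi IH'|k phi IH] n v w //=.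
- by move=> _ /game_iso H; have [] := H _ _ _ _ (eval_env v w s) (eval_env v w t).
- by move=> _ /game_iso H; have [] := H _ _ _ _ (eval_env v w s) (eval_env v w t).
- by move=> _ /game_iso H; have [_ _] := H _ _ _ _ (eval_env v w t) (eval_env v w t).
- rewrite geq_max => /andP[r r'] h.
  by rewrite (IH n v w) // (IH' n v w).
- case: n => [//|n] /= r [_ F B]; split=> H.
    move=> y; have [x h] := B y; rewrite -(IH n [tuple of x :: v]) //.
    by apply: game_sub h => a b /env_cons.
  move=> x; have [y h] := F x; rewrite (IH n _ [tuple of y :: w]) //.
  by apply: game_sub h => a b /env_cons.
Qed.

Lemma atoms_iso (M N : structure L) k (v : k.-tuple M) (w : k.-tuple N) :
  (forall i : atom_index k, sat (atom i) v <-> sat (atom i) w) ->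
  partial_iso (env v w).
Proof.
move=> H; have ix a b : env v w a b ->
    exists i, a = eval v (index_term i) /\ b = eval w (index_term i).
  by case=> [[c [-> ->]]|[i [-> ->]]]; [exists (inr c)|exists (inl i)].
move=> a b a' b' /ix[i [-> ->]] /ix[j [-> ->]]; split.
- exact: (H (inl (inl (i, j)))).
- exact: (H (inl (inr (i, j)))).
- by move=> p; exact: (H (inr (p, i))).
Qed.

(** The generators of rank at most [n.+1] tell which [n]-types of tuples with one more entry are
    realised, so between tuples of equal type every move has an answer of the same type. *)
Lemma type_of_game n (M N : structure L) k (v : k.-tuple M) (w : k.-tuple N) :
  type_of n v = type_of n w <-> game n (env v w).
Proof.
split; last first.
  move=> h; apply/ffunP => i; rewrite !ffunE; apply: asbool_equiv_eq.
  by apply: game_sat h; exact: qrank_generator.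
elim: n k v w => [|n IH] k v w e.
  apply: atoms_iso => i; apply: asbool_eq_equiv.
  by have /ffunP/(_ i) := e; rewrite !ffunE.
have dec (i : gen_index n.+1 k) : sat (generator i) v <-> sat (generator i) w.
  by apply: asbool_eq_equiv; have /ffunP/(_ i) := e; rewrite !ffunE.
(* The generator of [f] says that no node extends the tuple to one of type [f]. *)
have some (K : structure L) (u : k.-tuple K) f :
    ~ sat (generator (inr f : gen_index n.+1 k)) u <->
    exists x : K, type_of n [tuple of x :: u] = f.
  split=> [h|[x h]].
    apply: contrapT => nx; apply: h => x /sat_hintikka hx.
    by apply: nx; exists x.
  by move=> /(_ x); apply; apply/sat_hintikka.
split.
- by apply: atoms_iso => i; exact: (dec (inl i)).
- move=> x; set f := type_of n [tuple of x :: v].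
  have /some : ~ sat (generator (inr f : gen_index n.+1 k)) w.
    by move=> /dec; apply/some; exists x.
  case=> y /esym/IH h; exists y.
  by apply: game_sub h => a b /env_cons.
- move=> y; set f := type_of n [tuple of y :: w].
  have /some : ~ sat (generator (inr f : gen_index n.+1 k)) v.
    by move=> /dec; apply/some; exists y.
  case=> x /IH h; exists x.
  by apply: game_sub h => a b /env_cons.
Qed.

Lemma equiv_game n (M N : structure L) :
  equiv_upto n M N <-> game n (@consts L M N).
Proof.
have nil (K : structure L) : [tuple of [::] : seq K] = [tuple] by exact: val_inj.
have ce a b : env [tuple of [::] : seq M] [tuple of [::] : seq N] a b <-> consts a b.
  by split=> [[//|[[]]]|]; [|left].
split=> h.
  apply: (@game_sub _ _ _ _ (env [tuple of [::] : seq M] [tuple of [::] : seq N])).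
    by move=> a b /ce.
  apply/type_of_game/ffunP => i; rewrite !ffunE; apply: asbool_equiv_eq.
  by apply: h; exact: qrank_generator.
by move=> phi r; apply: (game_sat r); apply: game_sub h => a b /ce.
Qed.

End Hintikka.

(** * Expansions by constants and characteristic formulas *)

Lemma game_expand L (M N : structure L) k (v : k.-tuple M) (w : k.-tuple N) n
    (R : M -> N -> Prop) :
  @game _ (expand v) (expand w) n R <-> game n R.
Proof.
elim: n R => [|n IH] R //=; split=> -[H F B]; split=> //.
- by move=> x; have [y] := F x; exists y; apply/IH.
- by move=> y; have [x] := B y; exists x; apply/IH.
- by move=> x; have [y] := F x; exists y; apply/IH.
- by move=> y; have [x] := B y; exists x; apply/IH.
Qed.

Lemma equiv_expand L (M N : structure L) k (v : k.-tuple M) (w : k.-tuple N) n :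
  equiv_upto n (expand v) (expand w) <-> game n (env v w).
Proof.
have ce a b : @consts _ (expand v) (expand w) a b <-> env v w a b.
  split; first by case=> -[c|i] [-> ->]; [left; exists c|right; exists i].
  by case=> [[c [-> ->]]|[i [-> ->]]]; [exists (inl c)|exists (inr i)].
rewrite equiv_game; split=> h.
  by apply/(game_expand v w); apply: game_sub h => a b /ce.
by move/(game_expand v w): h; apply: game_sub => a b /ce.
Qed.

Lemma game_env_expand L (M N : structure L) k (v : k.-tuple M) (w : k.-tuple N) n
    (a : M) (b : N) :
  game n (@env _ (expand v) (expand w) 1 [tuple a] [tuple b]) <->
  game n (ext (env v w) a b).
Proof.
have ce x y :
    @env _ (expand v) (expand w) 1 [tuple a] [tuple b] x y <-> ext (env v w) a b x y.
  split.
    case=> [[[c|i] [-> ->]]|[i [-> ->]]]; [by left; left; exists c| |].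
      by left; right; exists i.
    by right; rewrite (ord1 i).
  case=> [[[c [-> ->]]|[i [-> ->]]]|[-> ->]]; [by left; exists (inl c)| |].
    by left; exists (inr i).
  by right; exists ord0.
rewrite (game_expand v w); split; apply: game_sub => x y; by rewrite ce.
Qed.

(** [characteristic] asks for rank exactly [n], whereas Hintikka formulas are only known to have
    rank at most [n]; hence the padding. *)
Definition tau_type (L : language) n (i : 'I_#|type_index L n 1|) : formula L 1 :=
  fand (pad L n 1) (hintikka (enum_val i)).

Lemma sat_tau_type (L : language) n (i : 'I_#|type_index L n 1|)
    (M : structure L) (a : M) :
  sat (tau_type i) [tuple a] <-> i = enum_rank (type_of n [tuple a]).
Proof.
rewrite sat_and sat_hintikka; split=> [[_ ->]|->]; first by rewrite enum_valK.
by rewrite enum_rankK; split=> //; exact: sat_pad.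
Qed.

Lemma characteristic_tau_type (L : language) n :
  characteristic n (@tau_type L n).
Proof.
split.
- move=> i; rewrite qrank_and qrank_pad.
  by apply/maxn_idPl; exact: qrank_hintikka.
- move=> M a; exists (enum_rank (type_of n [tuple a])); split.
    exact/sat_tau_type.
  by move=> i /sat_tau_type.
- move=> M N a b; rewrite equiv_expand -type_of_game; split.
    by case=> i [/sat_tau_type -> /sat_tau_type/enum_rank_inj].
  move=> e; exists (enum_rank (type_of n [tuple a])).
  by split; apply/sat_tau_type; rewrite ?e.
Qed.

(** Variegation concerns arbitrary characteristic families, and this connects each of them to games.
    The index shared by [a] and [b] must be [i], by uniqueness. *)
Lemma characteristic_game L n m (tau : 'I_m -> formula L 1) (M N : structure L)
    (a : M) (b : N) i :
  characteristic n tau -> game n (env [tuple a] [tuple b]) ->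
  sat (tau i) [tuple a] -> sat (tau i) [tuple b].
Proof.
case=> _ uniq cmp /equiv_expand/cmp[j [ja jb]] ia.
by have [k [_ u]] := uniq M a; rewrite -(u _ ia) (u _ ja).
Qed.

(** * Paths *)

Section Paths.
Variables (L : language) (T : structure L).
Implicit Types (A : set T) (x y z a b c t : T).

Lemma tree_order : is_tree T -> forest_order T.
Proof. by case. Qed.

Hypothesis fT : forest_order T.

Lemma slt_irr x : ~ slt x x. Proof. by case: fT. Qed.

Lemma slt_trans x y z : slt x y -> slt y z -> slt x z.
Proof. by case: fT => _ tr _; exact: tr. Qed.

Lemma sle_lt_trans x y z : sle x y -> slt y z -> slt x z.
Proof. by move=> [|-> //]; exact: slt_trans. Qed.

Lemma lt_sle_trans x y z : slt x y -> sle y z -> slt x z.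
Proof. by move=> h [|<- //]; exact: slt_trans. Qed.

Lemma sle_trans x y z : sle x y -> sle y z -> sle x z.
Proof. by move=> h [|<- //] /(sle_lt_trans h); left. Qed.

Lemma down_linear t x y : sle x t -> sle y t -> comparable_nodes x y.
Proof. by case: fT => _ _ dl; exact: dl. Qed.

Lemma path_maximal A x :
  tree_path A -> (forall a, A a -> comparable_nodes x a) -> A x.
Proof.
case=> lin mx h; rewrite -(mx (A `|` [set x])); first by right.
  move=> a b [Aa|->] [Ab|->].
  - exact: lin.
  - by case: (h _ Aa) => [|//|->]; [constructor 2|constructor 1|constructor 3].
  - exact: h.
  - by constructor 3.
by move=> a; left.
Qed.

Lemma path_down A x y : tree_path A -> A y -> sle x y -> A x.
Proof.
move=> pA Ay xy; apply: path_maximal => // a Aa.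
have [ya|ay|e] := (proj1 pA) _ _ Ay Aa.
- by constructor 1; apply: sle_lt_trans ya.
- by apply: (@down_linear y) => //; left.
- by apply: (@down_linear y) => //; right.
Qed.

Lemma open_next A a : open_path A -> A a -> exists2 b, A b & slt a b.
Proof.
case=> pA nm Aa; apply: contrapT => h; apply: nm; exists a => // b Ab.
have [ab|ba|->] := (proj1 pA) _ _ Aa Ab; [|by left|by right].
by exfalso; apply: h; exists b.
Qed.

Lemma open_not_leaf A a : open_path A -> A a -> ~ leaf a.
Proof. by move=> oA /(open_next oA)[b _ ab] /(_ b). Qed.

(** If [x] is in [A], it serves itself. Otherwise not all of [A] is below [x], since maximality
    would then put [x] into [A]. *)
Lemma open_avoid A x : open_path A -> exists2 s, A s & ~ slt s x.
Proof.
move=> oA; have [Ax|nAx] := pselect (A x).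
  by exists x => //; exact: slt_irr.
apply: contrapT => h; apply: nAx; apply: path_maximal; first by case: oA.
move=> a Aa; constructor 2; apply: contrapT => nax; apply: h.
by exists a.
Qed.

Lemma leaf_closed_path c : leaf c -> closed_path [set y | sle y c].
Proof.
move=> lc; split; last by exists c => //; right.
split; first by move=> x y; exact: down_linear.
move=> B linB sub; apply/seteqP; split=> // x Bx.
have [||->] := linB _ _ Bx (sub c (or_intror erefl)); [by left|by move/lc|by right].
Qed.

Lemma closed_pathP A : closed_path A -> exists2 c, leaf c & forall y, A y <-> sle y c.
Proof.
case=> pA [c Ac mx]; exists c; last first.
  by move=> y; split=> [/mx //|]; exact: path_down.
move=> y cy; have /mx[yc|e] : A y.
- apply: path_maximal => // a /mx ac; constructor 2; exact: sle_lt_trans cy.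
- by case: (slt_irr (slt_trans cy yc)).
- by move: cy; rewrite e; exact: slt_irr.
Qed.

(** By induction over the indices: the larger of two witnesses serves for both conditions, which
    persist upwards. *)
Lemma linear_common (I : finType) A (Q : I -> T -> Prop) :
  linear_set A -> A !=set0 ->
  (forall i s s', A s' -> Q i s -> sle s s' -> Q i s') ->
  (forall i, exists2 s, A s & Q i s) -> exists2 s, A s & forall i, Q i s.
Proof.
move=> lin [s0 A0] up ex.
suff [s As h] : exists2 s, A s & forall i, i \in enum I -> Q i s.
  by exists s => // i; apply: h; rewrite mem_enum.
elim: (enum I) => [|i e [s As h]]; first by exists s0.
have [s' As' hs'] := ex i.
have [l|l] : sle s s' \/ sle s' s.
  by case: (lin _ _ As As') => [||->]; [left; left|right; left|left; right].
- exists s' => // j; rewrite inE => /predU1P[->//|/h hj]; exact: up hj l.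
- exists s => // j; rewrite inE => /predU1P[->|/h //]; exact: up hs' l.
Qed.

(** If no class of [f] were cofinal, a single node of the chain would bound all of them, and with
    them [X]. *)
Lemma cofinal_pigeonhole (I : finType) A (X : set T) (f : T -> I) :
  linear_set A -> A !=set0 -> cofinal A X ->
  exists i, cofinal A [set t | X t /\ f t = i].
Proof.
move=> lin A0 [sub cof]; apply: contrapT => /forallNP h.
have [||s As hs] := @linear_common I A
    (fun i s => forall t, X t -> f t = i -> ~ sle s t) lin A0.
- move=> i s s' _ hs ss' t Xt e s't; apply: (hs t Xt e); exact: sle_trans s't.
- move=> i; apply: contrapT => hi; apply: (h i); split=> [t []|s As]; first by move/sub.
  apply: contrapT => ht; apply: hi; exists s => // t Xt e st.
  by apply: ht; exists t.
have [t Xt st] := cof _ As; exact: hs Xt erefl st.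
Qed.

End Paths.

(** The position in which [(M; a)] is compared with [(N; b)]. *)
Definition pinned L (M N : structure L) (a : M) (b : N) : M -> N -> Prop :=
  ext (@consts L M N) a b.

Lemma env1 L (M N : structure L) (a : M) (b : N) x y :
  env [tuple a] [tuple b] x y <-> pinned a b x y.
Proof.
split; first by case=> [|[i [-> ->]]]; [left|right; rewrite (ord1 i)].
by case=> [|[-> ->]]; [left|right; exists ord0].
Qed.

Lemma env2 L (M N : structure L) (a a' : M) (b b' : N) x y :
  env [tuple a; a'] [tuple b; b'] x y <-> ext (pinned a b) a' b' x y.
Proof.
split.
  case=> [h|[i [-> ->]]]; first by left; left.
  by case: (unliftP ord0 i) => [j ->|->]; [right; rewrite (ord1 j)|left; right].
case=> [[h|[-> ->]]|[-> ->]]; first by left.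
  by right; exists ord0.
by right; exists (lift ord0 ord0).
Qed.

(** * Types along closed and open paths *)

Section Focality.
Variables (L : language) (T : structure L).
Hypotheses (T_tree : is_tree T) (T_focal : focal T) (T_variegated : variegated T).
Let fT := tree_order T_tree.
Implicit Types (B : set T) (a b c d s t : T).

(** Focality is applied to the Hintikka formula of [(a, b)]. The additional round shows that [d],
    like [b], is not a leaf; being comparable with the leaf [c], it lies below [c]. *)
Lemma closed_occurrence a b c k :
  leaf c -> slt a c -> sle a b -> ~ leaf b ->
  exists d, [/\ sle a d, slt d c & game k (ext (pinned a a) b d)].
Proof.
move=> lc ac ab nlb.
pose phi : formula L 2 := hintikka (type_of k.+1 [tuple a; b]).
have [|d [ad dc /sat_hintikka e]] := T_focal (a := a) (phi := phi) _ (c := c) (or_introl ac).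
  by exists b; split=> //; apply/sat_hintikka.
have {e} g : game k.+1 (ext (pinned a a) b d).
  by move/esym/type_of_game: e; apply: game_sub => x y /env2.
have nld : ~ leaf d by move=> /(game_leaf (game_sym g) (or_intror (conj erefl erefl))).
exists d; split=> //; last exact: gameS.
by case: dc => [//|/lc //|e]; case: nld; rewrite e.
Qed.

(* Sets closed under n-equivalence over [a] are unions of n-types of
   (T; a), so spectra decide whether they are cofinal. *)
Lemma closed_twin n B a : open_path B -> B a ->
  exists c, [/\ leaf c, slt a c & forall X : set T,
    (forall y y', X y -> game n (ext (pinned a a) y y') -> X y') ->
    cofinal B (B `&` X) <-> cofinal [set t | slt t c] ([set t | slt t c] `&` X)].
Proof.
move=> oB Ba; have nl := open_not_leaf oB.
have tau := characteristic_tau_type (expand_language L 1) n.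
have [C cC eqS] := T_variegated [tuple a] oB tau.
have [c lc Cc] := closed_pathP fT cC.
have eB : without_leaf B = B.
  by apply/seteqP; split=> t; [case|move=> Bt; split=> //; exact: nl].
have eC : without_leaf C = [set t | slt t c].
  apply/seteqP; split=> t; last by move=> tc; split; [apply/Cc; left|move/(_ c)].
  by case=> /Cc[//|->].
pose f (t : T) := enum_rank (type_of n (M := expand [tuple a]) [tuple t]).
have same y y' : f y = f y' -> game n (ext (pinned a a) y y').
  move=> /enum_rank_inj/type_of_game/game_env_expand.
  by apply: game_sub => u w [/env1|]; [left|right].
have spec (A : set T) i : spectrum (T := expand [tuple a]) (@tau_type _ n) A i <->
    cofinal (without_leaf A) (without_leaf A `&` [set t | f t = i]).
  suff -> : without_leaf A `&` [set t | f t = i] = [set t | without_leaf A t /\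
      sat (M := expand [tuple a]) (tau_type i) [tuple t]] by [].
  apply/seteqP; split=> t [At e]; split=> //; first exact/sat_tau_type/esym.
  by move/sat_tau_type: e.
(* By the pigeonhole principle some type is cofinal in [A] within [X]. It belongs to the spectrum of
   [A], hence to that of [A'], and all its nodes lie in [X]. *)
have half (A A' X : set T) : linear_set A -> A !=set0 -> without_leaf A = A ->
    spectrum (T := expand [tuple a]) (@tau_type _ n) A `<=`
    spectrum (T := expand [tuple a]) (@tau_type _ n) A' ->
    (forall y y', X y -> game n (ext (pinned a a) y y') -> X y') ->
    cofinal A (A `&` X) -> cofinal (without_leaf A') (without_leaf A' `&` X).
  move=> lin A0 eA sub satX cof.
  have [i cofi] := cofinal_pigeonhole fT f lin A0 cof.
  have /spec[_ cof'] : spectrum (T := expand [tuple a]) (@tau_type _ n) A' i.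
    apply/sub/spec; rewrite eA; split; first by move=> t [].
    by move=> s /(proj2 cofi)[t [[At Xt] e] st]; exists t.
  split; first by move=> t [].
  have [s0 As0] := A0; have [t [[At Xt] e] _] := proj2 cofi s0 As0.
  move=> s /cof'[y [Ay fy] sy]; exists y => //; split=> //.
  by apply: satX Xt _; apply: same; rewrite e -fy.
have C0 : [set t | slt t c] !=set0.
  have [_ _ _ _ con] := T_tree.
  have [x [xc [xa|xa]]] := con c a.
    case: xc => [|e]; first by exists x.
    by move: xa; rewrite e => /lc.
  case: xc => [|e]; first by exists x.
  by case: (nl _ Ba); rewrite -xa e.
have linB : linear_set B by case: oB => -[].
have linC : linear_set [set t | slt t c].
  by move=> x y xc yc; apply: (down_linear fT (t := c)); left.
have eC' : without_leaf [set t | slt t c] = [set t | slt t c].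
  by apply/seteqP; split=> t; [case|move=> tc; split=> // /(_ c)].
have spC i : spectrum (T := expand [tuple a]) (@tau_type _ n) [set t | slt t c] i <->
    spectrum (T := expand [tuple a]) (@tau_type _ n) B i.
  by rewrite -eqS !spec eC eC'.
have twin (X : set T) : (forall y y', X y -> game n (ext (pinned a a) y y') -> X y') ->
    cofinal B (B `&` X) <-> cofinal [set t | slt t c] ([set t | slt t c] `&` X).
  move=> satX; split=> cof.
    rewrite -eC'; apply: (half B) cof => //; first by exists a.
    by move=> i /spC.
  by rewrite -eB; apply: (half [set t | slt t c]) cof => // i /spC.
exists c; split=> //.
(* Being above [a] is invariant under equivalence over [a] and cofinal in [B], so some node below
   [c] is above [a]. *)
have [_ cof] : cofinal [set t | slt t c] ([set t | slt t c] `&` [set y | slt a y]).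
  apply/twin.
    move=> y y' ay g.
    exact: (proj1 (game_lt g (or_introl (or_intror (conj erefl erefl)))
                             (or_intror (conj erefl erefl)))) ay.
  split=> [t []//|s Bs]; have [a' Ba' aa'] := open_next oB Ba.
  have [a's|sa'|e] := linB _ _ Ba' Bs.
  - by exists s; [split=> //; exact: slt_trans a's|right].
  - by exists a' => //; left.
  - by exists a' => //; right.
have [x xc] := C0; have [t [tc at' _]] := cof x xc.
exact: slt_trans tc.
Qed.

(** The type of [b] occurs at some [d] below the leaf of a closed twin of [B]. Nodes equivalent to
    nodes of [B] are cofinal there, so some [y'] above [d] matches a node [y] of [B]; the extra
    round answers [d] by a node below [y], hence on [B]. *)
Lemma open_occurrence B a b k :
  open_path B -> B a -> sle a b -> ~ leaf b ->
  exists d, [/\ B d, sle a d & game k (ext (pinned a a) b d)].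
Proof.
move=> oB Ba ab nlb.
have [c [lc ac twin]] := closed_twin k.+1 oB Ba.
have [d [ad dc g]] := closed_occurrence k lc ac ab nlb.
have [_ cof] : cofinal [set t | slt t c] ([set t | slt t c] `&`
    [set y' | exists2 y, B y & game k.+1 (ext (pinned a a) y y')]).
  apply/twin.
    move=> y y' [z Bz gz] g'; exists z => //.
    apply: game_sub (game_trans gz g') => u w [[[m [-> ->]]|[-> ->]]|[-> ->]].
    + by exists (iconst T m); split; left; left; exists m.
    + by exists a; split; left; right.
    + by exists y; split; right.
  split=> [t []//|s Bs]; exists s; last by right.
  split=> //; exists s => //; apply: game_sub (game_refl T k.+1) => u w.
  by case=> [[[m [-> ->]]|[-> ->]]|[-> ->]].
have [y' [y'c [y By /game_sym gy]] dy'] := cof d dc.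
have [d' {}gy] := game_forth d gy.
have {gy} g' : game k (ext (ext (pinned a a) y' y) d d').
  apply: game_sub gy => u w [[[[m [-> ->]]|[-> ->]]|[-> ->]]|[-> ->]].
  + by left; left; left; exists m.
  + by left; left; right.
  + by left; right.
  + by right.
have pd := or_intror (conj erefl erefl) : ext (ext (pinned a a) y' y) d d' d d'.
exists d'; split.
- have pB : tree_path B by case: oB.
  apply: (path_down fT pB By).
  by apply: game_sle g' pd _ dy'; left; right.
- by apply: game_sle g' _ pd ad; left; left; right.
- apply: game_sub (game_trans g g') => u w [[[m [-> ->]]|[-> ->]]|[-> ->]].
  + by exists (iconst T m); split; left; [left|left; left]; exists m.
  + by exists a; split; [left; right|left; left; right].
  + by exists d; split; [right|].
Qed.

Lemma leaf_above B a : open_path B -> B a -> exists2 c, leaf c & slt a c.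
Proof. by move=> oB Ba; have [c []] := closed_twin 0 oB Ba; exists c. Qed.

(* Focality makes every node above x comparable with a constant above x. *)
Lemma const_not_leaf B m : open_path B -> ~ leaf (iconst T m).
Proof.
move=> oB lm; have pB : tree_path B by case: oB.
have [_ _ _ _ con] := T_tree.
have [a Ba _] := open_avoid fT (iconst T m) oB.
have [x [xm xa]] := con (iconst T m) a.
have Bx := path_down fT pB Ba xa.
pose phi : formula L 2 := Eq (Var L (ord_max : 'I_2)) (Cst 2 m).
apply: (open_not_leaf oB _ lm); apply: path_maximal => // b Bb.
have [xb|bx|xb] := (proj1 pB) _ _ Bx Bb.
- have [|d [_ + e]] := T_focal (a := x) (phi := phi) _ (or_introl xb).
    by exists (iconst T m).
  by rewrite [d]e.
- by constructor 2; apply: lt_sle_trans xm.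
- by rewrite -xb; case: xm; [constructor 2|constructor 3].
Qed.

(** A constant above [t] is also above [s], and conversely. Its type over either node is realised on
    the path through that node, and only the constant itself has this type. A constant below [t] is
    below [s], and conversely. *)
Lemma const_transfer B c s t m :
  open_path B -> B s -> leaf c -> slt t c -> game 0 (pinned t s) ->
  slt (iconst T m) c <-> B (iconst T m).
Proof.
move=> oB Bs lc tc g; have pB : tree_path B by case: oB.
have nl := const_not_leaf (m := m) oB; set k := iconst T m in nl *.
have pk : pinned t s k k by left; exists m.
have pt : pinned t s t s by right.
have gs := game_sym g.
have same a d : game 0 (ext (pinned a a) k d) -> d = k.
  by move=> h; apply/esym/(game_eq h (a := k) (a' := k)) => //; [left; left; exists m|right].
split=> [kc|Bk].
- have [tk|kt|kt] := down_linear fT (or_introl tc) (or_introl kc).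
  + have sk : sle s k by apply: game_sle g pt pk _; left.
    by have [d [Bd _ /same <-]] := open_occurrence 0 oB Bs sk nl.
  + by apply: path_down Bs _ => //; apply: game_sle g pk pt _; left.
  + by apply: path_down Bs _ => //; apply: game_sle g pk pt _; right.
- have [sk|ks|ks] := (proj1 pB) _ _ Bs Bk.
  + have tk : sle t k by apply: game_sle gs pt pk _; left.
    by have [d [_ dc /same <-]] := closed_occurrence 0 lc tc tk nl.
  + by apply: sle_lt_trans tc => //; apply: game_sle gs pk pt _; left.
  + by apply: sle_lt_trans tc => //; apply: game_sle gs pk pt _; right.
Qed.

End Focality.

(** * Extensions by leaves *)

(** Common form of the inclusions of [T] in a stage, of a stage in a later one, and of [T] in the
    sum over all open paths. A new node is determined by the open path below it. *)
Record leaf_extension L (q : pred_sym L -> Prop) (T U : structure L) (h : T -> U) :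
    Prop := LeafExtension {
  ext_embedding : embedding h;
  ext_new_top : forall u x, ~ range h u -> ~ slt u x;
  ext_new_path : forall u, ~ range h u ->
    exists2 A : set T, open_path A & forall x, slt x u <-> (h @` A) x;
  ext_new_inj : forall u u', ~ range h u -> ~ range h u' ->
    (forall x, slt x u <-> slt x u') -> u = u';
  ext_new_pred : forall u p, ~ range h u -> (upred p u <-> q p) }.

Section Extension.
Variables (L : language) (q : pred_sym L -> Prop) (T U : structure L) (h : T -> U).
Hypotheses (T_tree : is_tree T) (T_monofolic : monofolic T) (T_focal : focal T)
  (T_variegated : variegated T)
  (q_leaf : forall (x : T) (p : pred_sym L), leaf x -> (q p <-> upred p x))
  (hU : leaf_extension q h).
Let fT := tree_order T_tree.
Implicit Types (A B : set T) (F : set T) (a b c d s t : T) (e u x y : U).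

Lemma ext_lt a b : slt (h a) (h b) <-> slt a b.
Proof. by have [_ + _ _] := ext_embedding hU; exact. Qed.

Lemma ext_inj : injective h.
Proof. by have [] := ext_embedding hU. Qed.

Lemma ext_const m : h (iconst T m) = iconst U m.
Proof. by have [_ _ + _] := ext_embedding hU; exact. Qed.

Lemma ext_pred p a : upred p (h a) <-> upred p a.
Proof. by have [_ _ _ +] := ext_embedding hU; exact. Qed.

Lemma below_old x u : slt x u -> exists a, x = h a.
Proof.
move=> xu; apply: contrapT => nx; apply: (ext_new_top hU _ xu).
by case=> a _ e; apply: nx; exists a.
Qed.

Lemma new_or_old u : (exists a, u = h a) \/ ~ range h u.
Proof.
have [[a _ <-]|] := pselect (range h u); by [left; exists a|right].
Qed.

Lemma ext_order : forest_order U.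
Proof.
split.
- move=> x xx; have [a e] := below_old xx; subst x; apply: (slt_irr fT (x := a)).
  by apply/ext_lt.
- move=> x y z xy; have [a e] := below_old xy; subst x.
  move=> yz; have [b e] := below_old yz; subst y.
  have [[c e]|nz] := new_or_old z.
    by subst z; apply/ext_lt; apply: (slt_trans fT (y := b)); apply/ext_lt.
  have [A [pA _] Az] := ext_new_path hU nz.
  have /Az[b' Ab' /ext_inj eb] := yz; subst b'.
  by apply/Az; exists a => //; apply: (path_down fT pA Ab'); left; apply/ext_lt.
- move=> t x y; case=> [xt|-> yt]; last by case: yt => [|->]; [constructor 2|constructor 3].
  case=> [yt|->]; last by constructor 1.
  have [a ea] := below_old xt; have [b eb] := below_old yt; subst x y.
  suff [/ext_lt|/ext_lt|->] : comparable_nodes a b.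
  + by constructor 1.
  + by constructor 2.
  + by constructor 3.
  have [[c e]|nz] := new_or_old t.
    by subst t; apply: (down_linear fT (t := c)); left; apply/ext_lt.
  have [A [[lin _] _] Az] := ext_new_path hU nz.
  by move: xt yt => /Az[a' Aa' /ext_inj <-] /Az[b' Ab' /ext_inj <-]; exact: lin.
Qed.
Let fU := ext_order.

(** Provides, on every open path, a node with nothing of [F] above it, so that a new leaf over the
    path can be handled inside that cone. All finite sets qualify, in particular the constants
    together with a finite tuple. *)
Definition avoidable F :=
  forall B, open_path B -> exists2 s, B s & forall a, F a -> ~ slt s a.

Lemma avoidableU F a : avoidable F -> avoidable (F `|` [set a]).
Proof.
move=> H B oB; have [s Bs hs] := H B oB; have [s' Bs' hs'] := open_avoid fT a oB.
have [[lin _] _] := oB.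
have [l|l] : sle s s' \/ sle s' s.
  by case: (lin _ _ Bs Bs') => [||->]; [left; left|right; left|left; right].
- exists s' => // b [/hs nb s'b|->//]; apply: nb; exact: sle_lt_trans s'b.
- exists s => // b [/hs //|-> sa]; apply: hs'; exact: sle_lt_trans sa.
Qed.

Lemma avoidable_range (J : finType) (f : J -> T) : avoidable (range f).
Proof.
move=> B oB; have [[lin _] _] := oB.
have [[t0] _ _ _ _] := T_tree; have [b0 Bb0 _] := open_avoid fT t0 oB.
have [|||s Bs hs] := @linear_common _ _ J B (fun j s => ~ slt s (f j)) lin.
- by exists b0.
- move=> i s s' _ ns ss' s'i; apply: ns; exact: sle_lt_trans s'i.
- by move=> i; exact: open_avoid.
by exists s => // a [j _ <-].
Qed.

Definition graph F (a : T) (u : U) : Prop := F a /\ u = h a.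

Lemma graph_iso F : partial_iso (graph F).
Proof.
move=> a x b y [_ ->] [_ ->]; split.
- by split=> [->|/ext_inj].
- by rewrite ext_lt.
- by move=> p; rewrite ext_pred.
Qed.

(** * The game between [T] and an extension by leaves *)

Lemma closed_avoid c t (y : T) : leaf c -> slt t c -> y <> c ->
  exists v : T, [/\ sle t v, slt v c & ~ slt v y].
Proof.
move=> lc tc nyc; have [yc|nyc'] := pselect (slt y c).
  have [ty|yt|e] := down_linear fT (or_introl tc) (or_introl yc).
  - by exists y; split=> //; [left|exact: slt_irr].
  - exists t; split=> //; first by right.
    by move=> ty; apply: (slt_irr fT (slt_trans fT yt ty)).
  - by exists t; split=> //; [right|rewrite e; exact: slt_irr].
(* Monofolicity: only [c] itself is above all predecessors of the leaf [c]. *)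
have [z zc nzy] : exists2 z, slt z c & ~ slt z y.
  apply: contrapT => H; apply: nyc; apply: T_monofolic => // z zc.
  by apply: contrapT => nz; apply: H; exists z.
have [tz|zt|e] := down_linear fT (or_introl tc) (or_introl zc).
- by exists z; split=> //; left.
- exists t; split=> //; first by right.
  by move=> ty; apply: nzy; exact: slt_trans ty.
- by exists t; split=> //; [right|rewrite e].
Qed.

(** An old node is avoided because [B] is open. A new node above all of [B] would have exactly [B]
    below it, by maximality, and so would be [e]. *)
Lemma new_avoid B e s x : open_path B -> ~ range h e ->
  (forall x, slt x e <-> (h @` B) x) -> B s -> x <> e ->
  exists u : T, [/\ sle s u, B u & ~ slt (h u) x].
Proof.
move=> oB ne Be Bs nxe; have pB : tree_path B by case: oB.
suff [u Bu nux] : exists2 u, B u & ~ slt (h u) x.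
  have [su|us|e'] := (proj1 pB) _ _ Bs Bu.
  - by exists u; split=> //; left.
  - exists s; split=> //; first by right.
    by move=> sx; apply: nux; apply: (slt_trans fU) sx; apply/ext_lt.
  - by exists s; split=> //; [right|rewrite e'].
have [[a ea]|nx] := new_or_old x.
  by subst x; have [u Bu nu] := open_avoid fT a oB; exists u => //; move/ext_lt.
have [A [pA _] Ax] := ext_new_path hU nx.
apply: contrapT => H; apply: nxe; apply: (ext_new_inj hU) => //.
have sub : B `<=` A.
  move=> b Bb; have /Ax[b' Ab' /ext_inj <- //] : slt (h b) x.
  by apply: contrapT => nb; apply: H; exists b.
have e' : A = B by apply: (proj2 pB) => //; case: pA.
by move=> y; rewrite Ax Be e'.
Qed.

(** Constants are placed alike relative to [c] and [e] by [const_transfer], and [q_leaf] makes the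
    predicates of [c] and [e] agree. *)
Lemma new_leaf_iso B c e s t : open_path B -> leaf c -> slt t c -> ~ range h e ->
  (forall x, slt x e <-> (h @` B) x) -> B s -> game 0 (@pinned L T T t s) ->
  partial_iso (ext (pinned t (h s)) c e).
Proof.
move=> oB lc tc ne Be Bs g; have pB : tree_path B by case: oB.
have old a x : pinned t (h s) a x -> exists b,
    [/\ x = h b, pinned t s a b & slt a c <-> B b].
  case=> [[m [-> ->]]|[-> ->]]; last by exists s; split=> //; right.
  exists (iconst T m); split; [by rewrite ext_const|by left; exists m|].
  exact: (const_transfer T_tree T_focal T_variegated m oB Bs lc tc g).
have cross a x : pinned t (h s) a x ->
    [/\ a = c <-> x = e, slt a c <-> slt x e & slt c a <-> slt e x].
  move=> hx; have [b [ex pab ac]] := old _ _ hx; subst x; split.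
  (* Both equalities are false: [x] is old, and the leaf [c] is neither a constant nor [t]. *)
  - split=> e'; last by case: ne; exists b.
    case: hx e' => [[m [-> _]]|[-> _]] e'.
      by case: (const_not_leaf T_tree T_focal (m := m) oB); rewrite e'.
    by case: (slt_irr fT (x := t)); rewrite {2}e'.
  - rewrite ac Be; split=> [Bb|[b' Bb' /ext_inj <- //]]; by exists b.
  - by split=> [/lc //|/(ext_new_top hU ne)].
move=> a x a' x' [hx|[-> ->]] [hx'|[-> ->]].
- have [b [ex pab _]] := old _ _ hx; have [b' [ex' pab' _]] := old _ _ hx'; subst x x'.
  have [e1 l1 p1] := game_iso g pab pab'; split.
  + by rewrite e1; split=> [->|/ext_inj].
  + by rewrite ext_lt.
  + by move=> p; rewrite ext_pred.
- have [e1 l1 _] := cross _ _ hx; split=> //.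
  have [b [-> pab _]] := old _ _ hx; have [_ _ p1] := game_iso g pab pab.
  by move=> p; rewrite ext_pred.
- have [e1 _ l1] := cross _ _ hx'; split=> //.
    by split=> /esym/e1.
  by move=> p; rewrite (ext_new_pred hU) // (q_leaf _ lc).
- split=> //.
    by split=> /[dup] k; [move/(slt_irr fT)|move/(slt_irr fU)].
  by move=> p; rewrite (ext_new_pred hU) // (q_leaf _ lc).
Qed.

(** Induction on [n], with [s] and [t] varying. Their types agree for one round more than is to be
    played, which pays for matching a further node of one path with a node of the other. *)
Lemma new_leaf_game n B c e s t :
  (forall F, avoidable F -> game n (graph F)) ->
  open_path B -> leaf c -> slt t c -> ~ range h e ->
  (forall x, slt x e <-> (h @` B) x) -> B s -> game n.+1 (@pinned L T T t s) ->
  game n (ext (pinned t (h s)) c e).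
Proof.
move=> + oB lc + ne Be.
elim: n s t => [|n IH] s t E tc Bs g.
  by apply: (new_leaf_iso oB) => //; exact: gameW g.
have {}IH s' t' : slt t' c -> B s' -> game n.+1 (@pinned L T T t' s') ->
    game n (ext (pinned t' (h s')) c e).
  by apply: IH => F /E; exact: gameS.
have pB : tree_path B by case: oB.
have avoid2 s1 s2 : avoidable (range (iconst T) `|` [set s1] `|` [set s2]).
  by do 2!apply: avoidableU; exact: avoidable_range.
(* A match found within [T] is read between [T] and [U] by composing it with the inclusion on the
   constants, [s] and [u]. *)
have transfer v (u : T) : game n.+1 (ext (@pinned L T T t s) v u) ->
    game n.+1 (ext (pinned t (h s)) v (h u)).
  move=> g1; apply: game_sub (game_trans g1 (E _ (avoid2 s u))) => a x.
  case=> [[[m [-> ->]]|[-> ->]]|[-> ->]].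
  - exists (iconst T m); split; first by left; left; exists m.
    by split; [left; left; exists m|rewrite ext_const].
  - by exists s; split; [left; right|split=> //; left; right].
  - by exists u; split; [right|split=> //; right].
(* A move not above [v] is answered relative to the matched pair [v], [u]; the induction hypothesis
   takes over above that pair. *)
have glue v (u : T) a x : sle t v -> slt v c -> B u -> ~ slt v a ->
    game n.+1 (ext (@pinned L T T t s) v u) ->
    game n (ext (ext (pinned t (h s)) v (h u)) a x) ->
    game n (ext (ext (pinned t (h s)) c e) a x).
  move=> tv vc Bu nva g1 g2.
  have g3 : game n (ext (pinned v (h u)) c e).
    apply: IH => //; apply: game_sub g1 => b y [|]; last by right.
    by left; left.
  have := game_glue fT fU g2 g3 (or_introl (or_intror (conj erefl erefl)))
            (or_introl (or_intror (conj erefl erefl))).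
  apply: game_sub => b y [[[k|[-> ->]]|[-> ->]]|[-> ->]].
  - have [vb|nvb] := pselect (slt v b); last by left; split=> //; left; left; left.
    by right; split; [left; left|left].
  - left; split; first by left; left; right.
    case: tv => [tv vt|<-]; last exact: slt_irr.
    exact: (slt_irr fT (slt_trans fT tv vt)).
  - by right; split; [right|left].
  - by left; split=> //; right.
have gce : game n (ext (pinned t (h s)) c e) by apply: IH => //; exact: gameS g.
have s_in : pinned t s t s by right.
split; first exact: game_iso gce.
- move=> a; have [->|ac] := pselect (a = c).
    exists e; apply: game_sub gce => b y [//|[-> ->]]; by right.
  have [v [tv vc nva]] := closed_avoid lc tc ac.
  have [u0 g0] := game_forth v g.
  have su0 : sle s u0 by apply: game_sle g0 (or_introl s_in) (or_intror (conj erefl erefl)) tv.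
  have nlu0 : ~ leaf u0.
    move=> /(game_leaf (game_sym g0) (or_intror (conj erefl erefl))) /(_ c).
    exact.
  (* The answer [u0] need not lie on [B]; it is replaced by a node of [B] with the same type over
     [s]. *)
  have [u [Bu su g1]] := open_occurrence T_tree T_focal T_variegated n.+1 oB Bs su0 nlu0.
  have {}g1 : game n.+1 (ext (@pinned L T T t s) v u).
    apply: game_sub (game_trans g0 g1) => b y [[[m [-> ->]]|[-> ->]]|[-> ->]].
    + by exists (iconst T m); split; left; left; exists m.
    + by exists s; split; left; right.
    + by exists u0; split; right.
  have [x gx] := game_forth a (transfer _ _ g1); exists x; exact: glue gx.
- move=> x; have [->|xe] := pselect (x = e).
    exists c; apply: game_sub gce => b y [//|[-> ->]]; by right.
  have [u [su Bu nux]] := new_avoid oB ne Be Bs xe.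
  have [v0 g0] := game_back u g.
  have tv0 : sle t v0.
    by apply: game_sle (game_sym g0) (or_introl s_in) (or_intror (conj erefl erefl)) su.
  have nlv0 : ~ leaf v0.
    move=> /(game_leaf g0 (or_intror (conj erefl erefl))).
    exact: open_not_leaf Bu.
  (* Symmetrically, [v0] is replaced by a node below [c] with the same type over [t]. *)
  have [v [tv vc g1]] := closed_occurrence T_focal n.+1 lc tc tv0 nlv0.
  have {}g1 : game n.+1 (ext (@pinned L T T t s) v u).
    apply: game_sub (game_trans (game_sym g1) g0) => b y [[[m [-> ->]]|[-> ->]]|[-> ->]].
    + by exists (iconst T m); split; left; left; exists m.
    + by exists t; split; left; right.
    + by exists v0; split; right.
  have [a ga] := game_back x (transfer _ _ g1); exists a; apply: (glue _ _ _ _ tv vc Bu _ g1 ga).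
  move=> va; apply: nux.
  exact: (proj1 (game_lt ga (or_introl (or_intror (conj erefl erefl)))
                            (or_intror (conj erefl erefl)))) va.
Qed.

Lemma graph_game n F : avoidable F -> game n (graph F).
Proof.
elim: n F => [|n IH] F aF; first exact: graph_iso.
split; first exact: graph_iso.
- move=> a; exists (h a); apply: game_sub (IH _ (avoidableU a aF)) => b y.
  by case=> [[Fb ->]|[-> ->]]; split=> //; [left|right].
- move=> x; have [[a ->]|nx] := new_or_old x.
    exists a; apply: game_sub (IH _ (avoidableU a aF)) => b y.
    by case=> [[Fb ->]|[-> ->]]; split=> //; [left|right].
  have [B oB Bx] := ext_new_path hU nx.
  have [s Bs ns] := aF B oB.
  have [c lc sc] := leaf_above T_tree T_variegated oB Bs.
  have g : game n (ext (pinned s (h s)) c x).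
    apply: (new_leaf_game IH oB) => //.
    apply: game_sub (game_refl T n.+1) => a b.
    by case=> [[m [-> ->]]|[-> ->]].
  exists c.
  have gs := IH _ (avoidableU s aF).
  (* Outside the cone above [s] the inclusion is played, inside it the game between [c] and [x]; no
     node of [F] is strictly above [s]. *)
  apply: game_sub (game_glue fT fU gs g (conj (or_intror erefl) erefl)
            (or_introl (or_intror (conj erefl erefl)))) => a y.
  case=> [[Fa ->]|[-> ->]]; last by right; split; [right|left].
  by left; split; [split=> //; left|exact: ns].
Qed.

Lemma old_game n (J : finType) (f : J -> T) :
  game n (fun a u => consts a u \/ exists j, a = f j /\ u = h (f j)).
Proof.
pose f' (j : const_sym L + J) := match j with inl m => iconst T m | inr j => f j end.
apply: game_sub (graph_game n (avoidable_range f')) => a u.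
case=> [[m [-> ->]]|[j [-> ->]]].
  by split; [exists (inl m)|rewrite ext_const].
by split; [exists (inr j)|].
Qed.

Lemma ext_elementary : elementary h.
Proof.
move=> k phi v; apply: (game_sat (leqnn _)).
apply: game_sub (old_game (qrank phi) (tnth v)) => a u [|[i [-> ->]]]; first by left.
by right; exists i; rewrite tnth_map.
Qed.

Lemma pinned_game n a : game n (pinned a (h a)).
Proof.
apply: game_sub (old_game n (fun _ : unit => a)) => b u [k|[-> ->]]; first by left.
by right; exists tt.
Qed.

Lemma pinned_game2 n a b : game n (ext (pinned a (h a)) b (h b)).
Proof.
apply: game_sub (old_game n (fun i : bool => if i then a else b)) => c u.
by case=> [[k|[-> ->]]|[-> ->]]; [left|right; exists true|right; exists false].
Qed.

(** * Properties inherited by the extension *)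

Lemma ext_tree : is_tree U.
Proof.
have [[t0] _ _ _ con] := T_tree.
have [irr tr dl] := ext_order; split=> // [|x y]; first by exists; exact: h.
(* Connectedness involves three nodes, hence three rounds: [x] and [y] are pulled back to [T], and a
   common lower bound is pushed forward. *)
have [a ga] := game_back x (pinned_game 3 t0).
have [b gb] := game_back y ga.
have [c [ca cb]] := con a b.
have [z gz] := game_forth c gb.
exists z; split.
- by apply: game_sle gz _ _ ca; [right|left; left; right].
- by apply: game_sle gz _ _ cb; [right|left; right].
Qed.

(** Two rounds pull [x] and [y] back. The third serves twice: to see that [a] is a leaf, and to push
    a predecessor of [a] forward. *)
Lemma ext_monofolic : monofolic U.
Proof.
have [[t0] _ _ _ _] := T_tree.
move=> x y lx below.
have [a ga] := game_back x (pinned_game 3 t0).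
have [b gb] := game_back y ga.
have ax : ext (ext (pinned t0 (h t0)) a x) b y a x by left; right.
have bY : ext (ext (pinned t0 (h t0)) a x) b y b y by right.
apply: (proj1 (game_eq gb bY ax)); apply: T_monofolic.
  exact: (game_leaf (game_sym gb) ax).
move=> c ca; have [z gz] := game_forth c gb.
have cz : ext (ext (ext (pinned t0 (h t0)) a x) b y) c z c z by right.
apply: (proj2 (game_lt gz cz (or_introl bY))); apply: below.
exact: (proj1 (game_lt gz cz (or_introl ax))).
Qed.

Lemma ext_focal : focal U.
Proof.
move=> x phi [y [xy sxy]] z xz; have [[a ex]|nx] := new_or_old x; last first.
  have top w : sle x w -> w = x by case=> [/(ext_new_top hU nx)|].
  exists x; split; [by right|by rewrite (top _ xz); constructor 3|].
  by move: sxy; rewrite (top _ xy).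
(* The two rounds for [c] and [d] leave [qrank phi] rounds to transfer [phi]. *)
subst x; have g := pinned_game (qrank phi).+2 a.
have pa : pinned a (h a) a (h a) by right.
have [b gb] := game_back y g; have [c gc] := game_back z g.
have ac : sle a c.
  by apply: game_sle (game_sym gc) (or_introl pa) _ xz; right.
have [|d [ad dc sd]] := T_focal (a := a) (phi := phi) _ ac.
  exists b; split.
    by apply: game_sle (game_sym gb) (or_introl pa) _ xy; right.
  apply: (proj2 (game_sat (n := (qrank phi).+1) _ _)) sxy; first exact: leqnSn.
  by apply: game_sub gb => u w /env2.
have [w gw] := game_forth d gc; exists w; split.
- by apply: game_sle gw (or_introl (or_introl pa)) _ ad; right.
- by apply: game_comparable gw _ _ dc; [right|left; right].
- apply: (proj1 (game_sat (leqnn _) _)) sd.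
  by apply: game_sub gw => u v /env2[|]; [left; left|right].
Qed.

(** New nodes lie above open paths only, and these contain no leaf. *)
Lemma old_leaf c : leaf c -> leaf (h c).
Proof.
move=> lc x cx; have [[a ex]|nx] := new_or_old x.
  by subst x; move/ext_lt: cx => /lc.
have [A oA Ax] := ext_new_path hU nx.
by have /Ax[c' Ac' /ext_inj e] := cx; apply: (open_not_leaf oA Ac'); rewrite e.
Qed.

Lemma ext_leaf_pred x p : leaf x -> (q p <-> upred p x).
Proof.
move=> lx; have [[a ex]|nx] := new_or_old x; last by rewrite (ext_new_pred hU).
subst x; rewrite ext_pred; apply: q_leaf => b ab.
by apply: (lx (h b)); apply/ext_lt.
Qed.

Lemma open_path_old (B : set U) : open_path B ->
  open_path (h @^-1` B) /\ h @` (h @^-1` B) = B.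
Proof.
move=> oB; have [[lin mx] nm] := oB.
have old : h @` (h @^-1` B) = B.
  apply/seteqP; split=> [_ [a Ba <-] //|x Bx].
  have [[a ex]|nx] := new_or_old x; first by exists a => //; rewrite /preimage /= -ex.
  by case: (open_not_leaf oB Bx) => y /(ext_new_top hU nx).
split=> //; split; first split.
- move=> a b Ba Bb; have [/ext_lt|/ext_lt|/ext_inj] := lin _ _ Ba Bb.
  + by constructor 1.
  + by constructor 2.
  + by constructor 3.
- move=> D linD sub; apply/seteqP; split=> // d Dd; rewrite /preimage /=.
  rewrite -(mx (h @` D)); first by exists d.
    move=> _ _ [a Da <-] [b Db <-].
    have [/ext_lt|/ext_lt|->] := linD _ _ Da Db.
    + by constructor 1.
    + by constructor 2.
    + by constructor 3.
  by rewrite -old => _ [a /sub Da <-]; exists a.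
- case=> m Bm max; apply: nm; exists (h m) => // x; rewrite -{1}old => -[a Ba <-].
  by case: (max a Ba) => [/ext_lt|->]; [left|right].
Qed.

(** The tuple may contain new leaves, so variegation of [T] cannot be applied to it directly. Beyond
    a node [t] of [B] with no entry of the tuple above it, types over the tuple are determined by
    types over [t], to which [closed_twin] applies. *)
Lemma ext_variegated : variegated U.
Proof.
move=> n B' k v m tau oB' ctau.
have [oB eB'] := open_path_old oB'; set B := h @^-1` B' in oB eB'.
have [t Bt nt] : exists2 t, B t & forall i, ~ slt (h t) (tnth v i).
  have [[t0] _ _ _ _] := T_tree; have [b0 Bb0 _] := open_avoid fT t0 oB.
  have [||||u] := @linear_common _ _ 'I_k B' (fun i u => ~ slt u (tnth v i)).
  - by case: oB' => -[].
  - by exists (h b0).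
  - move=> i s s' _ ns ss' s'i; apply: ns; exact: sle_lt_trans s'i.
  - by move=> i; exact: open_avoid.
  by rewrite -eB' => -[t Bt <-] nt; exists t.
have [c [lc tc twin]] := closed_twin T_tree T_variegated n oB Bt.
have lhc := old_leaf lc.
exists [set y | sle y (h c)]; first exact: leaf_closed_path.
pose X j := [set y | sle t y /\ sat (M := expand v) (tau j) [tuple h y]].
(* Equivalence over [t] is carried from [T] to [U], then glued at [h t] with the identity outside
   the cone, where the tuple lies. *)
have satX j (y y' : T) : X j y -> game n (ext (@pinned L T T t t) y y') -> X j y'.
  move=> [ty sy] g.
  have ty' : sle t y' by apply: game_sle g _ _ ty; [left; right|right].
  split=> //; apply: characteristic_game ctau _ sy; apply/game_env_expand.
  have g1 : game n (ext (@pinned L U U (h t) (h t)) (h y) (h y')).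
    have := game_trans (game_sym (pinned_game2 n t y)) (game_trans g (pinned_game2 n t y')).
    apply: game_sub => _ _ [[[j' [-> ->]]|[-> ->]]|[-> ->]].
    - exists (iconst T j'); split; first by left; left; exists j'.
      by exists (iconst T j'); split; left; left; exists j'.
    - by exists t; split; [left; right|exists t; split; left; right].
    - by exists y; split; [right|exists y'; split; right].
  apply: game_sub (game_glue fU fU (game_refl U n) g1 (y := h t) erefl _).
    move=> _ _ [[[j' [-> ->]]|[i [-> ->]]]|[-> ->]].
    + have [l|l] := pselect (slt (h t) (iconst U j')); last by left.
      by right; split; [left; left; exists j'|left].
    + by left; split=> //; exact: nt.
    + right; split; first by right.
      by case: ty => [/ext_lt|->]; [left|right].
  by left; right.
have wB : without_leaf B' = h @` B.
  rewrite eB'; apply/seteqP; split=> x; first by case.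
  by move=> Bx; split=> //; exact: open_not_leaf Bx.
have wC : without_leaf [set y | sle y (h c)] = h @` [set s | slt s c].
  apply/seteqP; split=> [x [[xc|->] // _]|_ [s sc <-]].
    by have [s e] := below_old xc; subst x; exists s => //; apply/ext_lt.
  by split; [left; apply/ext_lt|move=> /(_ (h c)); rewrite ext_lt].
(* Restricting type [j] to nodes above [t] does not affect cofinality, as [t] lies on the path. *)
have spec (P' : set U) (P : set T) j : linear_set P -> P t -> without_leaf P' = h @` P ->
    cofinal P (P `&` X j) <-> spectrum (T := expand v) tau P' j.
  move=> lin Pt eP; rewrite /spectrum /=.
  have -> : @without_leaf _ (expand v) P' = h @` P by [].
  split=> -[_ cof]; split=> [x []//|].
  - move=> _ [s Ps <-]; have [y [Py [ty sy]] sy'] := cof s Ps.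
    exists (h y); first by split=> //; exists y.
    by case: sy' => [/ext_lt|->]; [left|right].
  - move=> s Ps.
    have [s' Ps' [ss' ts']] : exists2 s', P s' & sle s s' /\ sle t s'.
      have [st|ts|->] := lin _ _ Ps Pt.
      + by exists t => //; split; [left|right].
      + by exists s => //; split; [right|left].
      + by exists t => //; split; right.
    have [_ [[y Py <-] sy] s'y] := cof (h s') (ex_intro2 _ _ s' Ps' erefl).
    have {}s'y : sle s' y by case: s'y => [/ext_lt|/ext_inj]; [left|right].
    exists y; last exact: sle_trans s'y.
    by split=> //; split=> //; exact: sle_trans s'y.
apply/funext => j; apply/propext.
rewrite -(spec _ [set s | slt s c]) // -?(spec B' B) //; last first.
- by move=> x y xc yc; apply: (down_linear fT (t := c)); left.
- by case: oB => -[].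
by apply: iff_sym; apply: twin; exact: satX.
Qed.

End Extension.

(** * Transfinite sums *)

Lemma embedding_comp L (M N P : structure L) (f : M -> N) (g : N -> P) :
  embedding f -> embedding g -> embedding (g \o f).
Proof.
move=> [fi fl fc fp] [gi gl gc gp]; split.
- exact: inj_comp.
- by move=> x y; rewrite /= gl fl.
- by move=> c; rewrite /= fc gc.
- by move=> p x; rewrite /= gp fp.
Qed.

(** The open path of [T] below a new node [u] must remain maximal in [S]. A node of [S] extending it
    would be new over [T], and its image would have the same predecessors as [u]; so [u] would be in
    the range of [g]. *)
Lemma leaf_extension_factor L q (T S U : structure L) (f : T -> S) (g : S -> U) :
  is_tree T -> leaf_extension q f -> leaf_extension q (g \o f) -> embedding g ->
  leaf_extension q g.
Proof.
move=> T_tree hf hgf hg; have fT := tree_order T_tree.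
have [gi gl _ _] := hg.
have new u : ~ range g u -> ~ range (g \o f) u.
  by move=> nu [a _ e]; apply: nu; exists (f a).
split=> //; first by move=> u x /new/(ext_new_top hgf); exact.
- move=> u nu; have [A oA Au] := ext_new_path hgf (new _ nu).
  exists (f @` A); last by move=> x; rewrite Au image_comp.
  have [pA nm] := oA; split; first split.
  + move=> _ _ [a Aa <-] [b Ab <-]; have [ab|ba|->] := (proj1 pA) _ _ Aa Ab.
    * by constructor 1; apply/(ext_lt hf).
    * by constructor 2; apply/(ext_lt hf).
    * by constructor 3.
  + move=> D linD sub; apply/seteqP; split=> // d Dd.
    have cmp a : A a -> comparable_nodes d (f a).
      by move=> Aa; apply: linD => //; apply: sub; exists a.
    have [[a ed]|nd] := new_or_old f d.
      subst d; exists a => //; apply: path_maximal => // b /cmp.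
      case=> [/(ext_lt hf)|/(ext_lt hf)|/(ext_inj hf)].
      * by constructor 1.
      * by constructor 2.
      * by constructor 3.
    have [B [pB _] Bd] := ext_new_path hf nd.
    have AB : A `<=` B.
      move=> a Aa; have [/(ext_new_top hf nd) //|/Bd[b Bb /(ext_inj hf) <-] //|e] := cmp _ Aa.
      by case: nd; exists a.
    have eAB : B = A by apply: (proj2 pA) => //; case: pB.
    have ngd : ~ range (g \o f) (g d).
      by case=> a _ /gi e; apply: nd; exists a.
    case: (nu); exists d => //; apply: (ext_new_inj hgf) => //; first exact: new.
    move=> x; rewrite Au -eAB; split.
      move=> xd; have [a e] := below_old hgf xd; subst x.
      by move/gl/Bd: xd => [b Bb /(ext_inj hf) <-]; exists b.
    by case=> a Ba <-; apply/gl/Bd; exists a.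
  + case=> _ [a Aa <-] mx; apply: nm; exists a => // b Ab.
    case: (mx (f b) (ex_intro2 _ _ b Ab erefl)) => [/(ext_lt hf)|/(ext_inj hf) ->]; by [left|right].
- by move=> u u' /new nu /new nu'; exact: (ext_new_inj hgf).
- by move=> u p /new; exact: (ext_new_pred hgf).
Qed.

Lemma add_leaves_extension L (T : structure L) (q : pred_sym L -> Prop) :
  leaf_extension q (@add_leaves_incl L T (@open_path L T) q).
Proof.
have new (u : add_leaves (@open_path L T) q) :
    ~ range (@add_leaves_incl L T (@open_path L T) q) u -> exists A, u = inr A.
  by case: u => [a|A] nu; [case: nu; exists a|exists A].
have below A (x : add_leaves (@open_path L T) q) :
    slt x (inr A) <-> (@add_leaves_incl L T (@open_path L T) q @` sval A) x.
  split; first by case: x => [a Aa|//]; exists a.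
  by case=> a Aa <-.
split.
- by split=> // x y [].
- by move=> u x /new[A ->].
- by move=> u /new[A ->]; exists (sval A) => //; exact: svalP.
- move=> u u' /new[A ->] /new[B ->] e.
  have eAB : sval A = sval B.
    apply/seteqP; split=> a Aa.
      by have /e/below[b Bb [<-]] : slt (inl a : add_leaves (@open_path L T) q) (inr A).
    by have /e/below[b Bb [<-]] : slt (inl a : add_leaves (@open_path L T) q) (inr B).
  case: A B eAB {e} => [A oA] [B oB] /= eAB; subst B.
  by rewrite (Prop_irrelevance oA oB).
- by move=> u p /new[A ->].
Qed.

(** * The stages as extensions by leaves *)

Section Stages.
Import Order.TTheory.
Variables (L : language) (T : structure L) (q : pred_sym L -> Prop).
Variables (d : Order.disp_t) (I : orderType d) (A : I -> set T).
Hypothesis I_wf : well_founded (fun i j : I => (i < j)%O).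
Hypothesis A_enum : set_bij [set: I] (@open_path L T) A.
Variable S : sum_sequence (trivial_tree q) A.

Let A_open i : open_path (A i).
Proof. by have [h _ _] := A_enum; exact: h. Qed.

Let A_inj : injective A.
Proof. by have [_ h _] := A_enum; move=> i j; apply: h; rewrite in_setT. Qed.

(** At a limit this is part of [sum_sequence]. At a successor the inclusion is, or factors through,
    that of the left summand of a sum. *)
Lemma stage_incl_embedding i j (ij : (i < j)%O) : embedding (stage_incl S ij).
Proof.
elim/(well_founded_ind I_wf): j i ij => j IH i ij.
have [lim|nlim] := pselect (is_limit j); first by have [H _] := stage_limit S lim.
have [k kj] : exists k, is_succ k j.
  apply: contrapT => nk; apply: nlim; split; first by move/(_ i); rewrite leNgt ij.
  by move=> k kj; apply: nk; exists k.
have [kj' kmin] := kj.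
have [f [fe _] fE] := stage_succ S kj' kj.
have ek : embedding (stage_incl S kj').
  rewrite (_ : stage_incl S kj' = f \o inl); last by apply/funext => x /=; rewrite fE.
  by apply: embedding_comp fe; split=> // x y [].
have : (i <= k)%O by rewrite leNgt; apply/negP => /kmin; rewrite leNgt ij.
rewrite le_eqVlt => /predU1P[e|ik].
  by subst k; rewrite (Prop_irrelevance ij kj').
rewrite (_ : stage_incl S ij = stage_incl S kj' \o stage_incl S ik).
  by apply: embedding_comp ek; exact: IH.
by apply/funext => x /=; rewrite (stage_incl_trans (s := S) ik kj' ij).
Qed.

Let base i : T -> S i := @stage_base L T _ d I A S i.

Let incl_base i j (ij : (i < j)%O) x : stage_incl S ij (base i x) = base j x.
Proof. exact: stage_incl_base. Qed.

(** The index below [i] recorded for each new node shows, [A] being injective, that the leaf added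
    above [A i] differs in its predecessors from all earlier ones. *)
Definition indexed_extension i : Prop :=
  leaf_extension q (base i) /\
  forall u, ~ range (base i) u ->
    exists2 k, (k < i)%O & forall x, slt x u <-> (base i @` A k) x.

Let base_embedding i j (ij : (i < j)%O) :
  indexed_extension i -> embedding (base j).
Proof.
move=> [hi _]; rewrite (_ : base j = stage_incl S ij \o base i).
  by apply: embedding_comp; [exact: ext_embedding hi|exact: stage_incl_embedding].
by apply/funext => x /=; rewrite incl_base.
Qed.

Let new_incl i j (ij : (i < j)%O) x :
  ~ range (base j) (stage_incl S ij x) -> ~ range (base i) x.
Proof. by move=> nx [a _ e]; apply: nx; exists a => //; rewrite -e incl_base. Qed.

Lemma indexed_extension_succ i j :
  is_succ i j -> indexed_extension i -> indexed_extension j.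
Proof.
move=> ij IH; have [ij' _] := ij; have [hi Hi] := IH.
have [f [[finj flt _ fp] fsur] fE] := stage_succ S ij' ij.
have fbase a : base j a = f (inl (base i a)) by rewrite fE incl_base.
have bj := base_embedding ij' IH; have [binj _ _ _] := bj.
have new u : ~ range (base j) u ->
    (exists2 x, u = f (inl x) & ~ range (base i) x) \/ u = f (inr tt).
  have [[x|[]] <-] := fsur u => nu; last by right.
  by left; exists x => //; apply: (new_incl (ij := ij')); rewrite -fE.
have below_inl x k : (forall y, slt y x <-> (base i @` A k) y) ->
    forall w, slt w (f (inl x)) <-> (base j @` A k) w.
  move=> xk w; have [z <-] := fsur w; rewrite flt; split.
    by case: z => [y /xk[a Aa <-]|//]; exists a.
  by case=> a Aa; rewrite fbase => /finj <- /=; apply/xk; exists a.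
have below_inr w : slt w (f (inr tt)) <-> (base j @` A i) w.
  have [z <-] := fsur w; rewrite flt; split.
    by case: z => [y [a Aa <-]|//]; exists a.
  by case=> a Aa; rewrite fbase => /finj <- /=; exists a.
have differ x u : ~ range (base i) x -> u = f (inl x) ->
    ~ (forall w, slt w u <-> slt w (f (inr tt))).
  move=> nx -> e; have [k ki xk] := Hi _ nx.
  suff eA : A k = A i by move: ki; rewrite (A_inj eA) ltxx.
  have mem (P P' : set T) : (forall w, (base j @` P) w <-> (base j @` P') w) -> P `<=` P'.
    move=> PP a Pa; have /PP[b Pb /binj <- //] : (base j @` P) (base j a) by exists a.
  apply/seteqP; split; apply: mem => w; rewrite -(below_inl _ _ xk) -below_inr //.
  exact: iff_sym.
split; first split=> //.
- move=> u w; have [z <-] := fsur w => /new[[x -> nx]|->] /flt.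
    by case: z => [y|[]] //=; [exact: (ext_new_top hi nx)|case=> a Aa e; apply: nx; exists a].
  by case: z.
- move=> u /new[[x -> /Hi[k ki xk]]|->]; last by exists (A i).
  by exists (A k) => //; exact: below_inl.
- move=> u u' /new[[x e nx]|->] /new[[x' e' nx']|->] // same.
  + subst u u'; congr (f (inl _)); apply: (ext_new_inj hi) => // y.
    exact: (iff_trans (iff_sym (flt (inl y) (inl x)))
      (iff_trans (same _) (flt (inl y) (inl x')))).
  + by case: (differ _ _ nx e).
  + by case: (differ _ _ nx' e') => w; apply: iff_sym.
- move=> u p /new[[x -> nx]|->]; rewrite fp //=; exact: (ext_new_pred hi).
- move=> u /new[[x -> /Hi[k ki xk]]|->]; last by exists i.
  by exists k; [exact: lt_trans ki ij'|exact: below_inl].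
Qed.

(** Any two nodes of the union come from a common earlier stage, where they can be compared. A
    predecessor of a new node is old, since new nodes stay maximal, so the path below a new node
    never grows. *)
Lemma indexed_extension_limit j : is_limit j ->
  (forall i, (i < j)%O -> indexed_extension i) -> indexed_extension j.
Proof.
move=> lim IH; have [_ cover] := stage_limit S lim.
have common u w : exists m (mj : (m < j)%O) x y,
    u = stage_incl S mj x /\ w = stage_incl S mj y.
  have [i [ij [x <-]]] := cover u; have [k [kj [y <-]]] := cover w.
  have [ik|ki|e] := ltgtP i k.
  - by exists k, kj, (stage_incl S ik x), y; rewrite (stage_incl_trans (s := S) ik kj ij).
  - by exists i, ij, x, (stage_incl S ki y); rewrite (stage_incl_trans (s := S) ki ij kj).
  - by subst k; exists i, ij, x, y; rewrite (Prop_irrelevance kj ij).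
have lt i (ij : (i < j)%O) x y :
    slt (stage_incl S ij x) (stage_incl S ij y) <-> slt x y.
  by have [_ + _ _] := stage_incl_embedding ij; exact.
have top u w : ~ range (base j) u -> ~ slt u w.
  have [m [mj [x [y [-> ->]]]]] := common u w => /new_incl nx /lt.
  exact: (ext_new_top (proj1 (IH m mj))).
have path u : ~ range (base j) u ->
    exists2 k, (k < j)%O & forall x, slt x u <-> (base j @` A k) x.
  move=> nu; have [i [ij [x ex]]] := cover u.
  have nx : ~ range (base i) x by apply: (new_incl (ij := ij)); rewrite ex.
  have [k ki xk] := proj2 (IH i ij) x nx.
  have [_ blt _ _] := ext_embedding (proj1 (IH i ij)).
  have [binj _ _ _] := ext_embedding (proj1 (IH i ij)).
  have old a : slt (base j a) u <-> A k a.
    rewrite -ex -(incl_base ij) lt xk; split=> [[b Ab /binj <- //]|Aa]; by exists a.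
  exists k; first exact: lt_trans ki ij.
  move=> w; split=> [wu|[a Aa <-]]; last exact/old.
  suff [a e] : exists a, w = base j a by exists a => //; apply/old; rewrite -e.
  apply: contrapT => nw; apply: (top w u) wu => -[a _ e].
  by apply: nw; exists a.
split=> //; split=> //.
- have [i ij] : exists i, (i < j)%O.
    apply: contrapT => ni; apply: (proj1 lim) => i; rewrite leNgt.
    by apply/negP => ij; apply: ni; exists i.
  exact: (base_embedding ij (IH i ij)).
- by move=> u /path[k kj uk]; exists (A k).
- move=> u u'; have [m [mj [x [y [-> ->]]]]] := common u u' => /new_incl nx /new_incl ny e.
  congr (stage_incl S mj _); apply: (ext_new_inj (proj1 (IH m mj))) => // z.
  by rewrite -(lt m mj z x) -(lt m mj z y).
- move=> u p; have [i [ij [x <-]]] := cover u => /new_incl nx.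
  have [_ _ _ ->] := stage_incl_embedding ij.
  exact: (ext_new_pred (proj1 (IH i ij))).
Qed.

Lemma stage_extension i : leaf_extension q (base i).
Proof.
suff [] : indexed_extension i by [].
elim/(well_founded_ind I_wf): i => j IH.
have [least|nleast] := pselect (is_least j).
  have [emb sur] := stage_zero S least.
  (* Stage zero is a copy of [T] and has no new nodes. *)
  have all u : ~ ~ range (base j) u by apply; have [x <-] := sur u; exists x.
  by split; first split=> //; move=> u *; case: (all u).
have [[k kj]|nk] := pselect (exists k, is_succ k j).
  by apply: (indexed_extension_succ kj); apply: IH; case: kj.
apply: indexed_extension_limit IH; split=> // k kj; by apply: nk; exists k.
Qed.

Lemma stage_incl_extension i j (ij : (i < j)%O) :
  is_tree T -> leaf_extension q (stage_incl S ij).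
Proof.
move=> T_tree; apply: (leaf_extension_factor T_tree (stage_extension i)).
  rewrite (_ : _ \o _ = base j); first exact: stage_extension.
  by apply/funext => x /=; rewrite incl_base.
exact: stage_incl_embedding.
Qed.

End Stages.

Theorem theorem6p3 (L : language) (T : structure L) (q : pred_sym L -> Prop)
    (T_tree : is_tree T) (T_ideal : ideal T) (T_monofolic : monofolic T)
    (T_wf : well_founded_tree T) (T_focal : focal T)
    (T_variegated : variegated T)
    (q_leaf : forall (x : T) (p : pred_sym L), leaf x -> (q p <-> upred p x)) :
  (forall (d : Order.disp_t) (I : orderType d)
          (I_wf : well_founded (fun i j : I => (i < j)%O))
          (I_limit : forall i : I, exists j : I, (i < j)%O)
          (A : I -> set T)
          (A_enum : set_bij [set: I]%classic (@open_path L T) A)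
          (S : sum_sequence (trivial_tree q) A),
     (forall (i j : I) (ij : (i < j)%O), elementary (stage_incl S ij)) /\
     (forall i : I, variegated (S i))) /\
  elementary (@add_leaves_incl L T (@open_path L T) q).
Proof.
split; last first.
  exact: (ext_elementary T_tree T_monofolic T_focal T_variegated q_leaf
    (add_leaves_extension T q)).
move=> d I I_wf _ A A_enum S.
have hS i := stage_extension I_wf A_enum S i.
have varS i : variegated (S i).
  exact: (ext_variegated T_tree T_monofolic T_focal T_variegated q_leaf (hS i)).
(* Stage [i] takes the role of [T], and stage [j] is an extension of it by leaves. *)
split=> // i j ij; apply: (ext_elementary (q := q)) => //.
- exact: (ext_tree T_tree T_monofolic T_focal T_variegated q_leaf (hS i)).
- exact: (ext_monofolic T_tree T_monofolic T_focal T_variegated q_leaf (hS i)).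
- exact: (ext_focal T_tree T_monofolic T_focal T_variegated q_leaf (hS i)).
- by move=> x p; exact: (ext_leaf_pred q_leaf (hS i)).
- exact: stage_incl_extension.
Qed.
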